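(* In the setting described in the context (a symmetric Markov extension $M/N$ satisfying the symmetric product, weak irreducibility and depth $2$ conditions), the centralizer $B=C_{M_2}(M)$ with its algebra structure, together with the comultiplication $\Delta$, the counit $\varepsilon$ and the map $S$ defined in the context, is a weak Hopf algebra with antipode $S$; moreover $B$ is semisimple. That is, $(B,\Delta,\varepsilon,S)$ is a semisimple weak Hopf algebra.
   Context: Conventions. $k$ is a field; algebras are unital associative $k$-algebras; summation over repeated indices (finite sums) is understood; $C_X(Y)$ is the centralizer of $Y$ in $X$; Sweedler notation $\Delta(h)=h_{(1)}\otimes h_{(2)}$ is used. Extensions. An algebra extension $M/N$ is Frobenius if there are an $N$-$N$-bimodule map $E:M\to N$ (Frobenius homomorphism) and finite families $\{x_i\},\{y_i\}$ in $M$ (dual bases for $E$) with $E(mx_i)y_i=m=x_iE(y_im)$ for all $m\in M$. It is strongly separable of index $\lambda^{-1}$ if also $E(1)=1$ and $x_iy_i=\lambda^{-1}1$ with $0\neq\lambda\in k$. It is a Markov extension if moreover there is a trace $T:N\to k$ (Markov trace) with $T(1)=1$ such that $T_0:=T\circ E$ is a trace on $M$. It is a symmetric Markov extension if moreover $E(ux)=E(xu)$ for all $x\in M$, $u\in U:=C_M(N)$. A $k$-algebra is Kanzaki separable if it has a separability element that is symmetric (invariant under the flip). Jones tower. $M_1=M\otimes_N M$, $e_1=1\otimes 1$, elements written $me_1m'=m\otimes m'$, product $(me_1m')(ne_1n')=mE(m'n)e_1n'$, unit $x_ie_1y_i$, $M\subset M_1$ via $m\mapsto mx_ie_1y_i$,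 and $E_M:M_1\to M$, $E_M(me_1m')=\lambda mm'$. $M_1/M$ is again a symmetric Markov extension of index $\lambda^{-1}$ with Frobenius homomorphism $E_M$ and Markov trace $T_0$. Iterating for $M_1/M$ gives $M_2=M_1e_2M_1$ and $E_{M_1}:M_2\to M_1$, $E_{M_1}(xe_2y)=\lambda xy$. Put $T_1=T_0\circ E_M$, $T_2=T_1\circ E_{M_1}$ (traces on $M_1$, $M_2$). Centralizers: $U=C_M(N)$, $V=C_{M_1}(M)$, $W=C_{M_2}(M_1)$, $A=C_{M_1}(N)$, $B=C_{M_2}(M)$, $C=C_{M_2}(N)$. $T$ also denotes the restriction of $T_2$ to $C$. Let $\phi:U\to V$, $\phi(u)=x_iue_1y_i$ (an algebra anti-isomorphism). Standing assumptions. (i) $M/N$ is a symmetric Markov extension. (ii) Symmetric product: $x_iy_i=y_ix_i=\lambda^{-1}1$ (alternatively, instead of $y_ix_i=\lambda^{-1}1$ one may assume $T_0|_U=T_1\circ\phi$). (iii) Weak irreducibility: $U$ is a Kanzaki separable $k$-algebra and $T_0|_U$ is a non-degenerate trace. (iv) Depth $2$: $E_M$ has dual bases lying in $A$, and $E_{M_1}$ has dual bases $\{u_j\},\{v_j\}$ lying in $B$. Structure on $B$. $f=f^{(1)}\otimes f^{(2)}$ is the unique symmetric separability element of $V$ and $w=[f^{(1)}T(f^{(2)})]^{-1}\in Z(V)$ (an invertible element of the center of $V$, with $f^{(1)}T(vwf^{(2)})=v$ for all $v\in V$). The bilinear forms $\langle a,b\rangle=\lambda^{-2}T(ae_2e_1wb)$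 and $\langle a,b\rangle'=\lambda^{-2}T(be_1e_2wa)$ on $A\times B$ are non-degenerate. Define $\Delta(b)=b_{(1)}\otimes b_{(2)}$ by $\langle a_1,b_{(1)}\rangle\langle a_2,b_{(2)}\rangle=\langle a_1a_2,b\rangle$ for all $a_1,a_2\in A$; $\varepsilon(b)=\langle 1,b\rangle$; and the linear bijection $S:B\to B$ by $\langle a,b\rangle=\langle a,S(b)\rangle'$ for all $a\in A$. Weak Hopf algebra. A weak Hopf algebra is a $k$-vector space $H$ with an algebra structure $(H,m,1)$ and a coalgebra structure $(H,\Delta,\varepsilon)$ such that: (1) $\Delta(hg)=\Delta(h)\Delta(g)$; (2) $\varepsilon(hgf)=\varepsilon(hg_{(1)})\varepsilon(g_{(2)}f)=\varepsilon(hg_{(2)})\varepsilon(g_{(1)}f)$ and $(\Delta\otimes\mathrm{id})\Delta(1)=(\Delta(1)\otimes1)(1\otimes\Delta(1))=(1\otimes\Delta(1))(\Delta(1)\otimes1)$; (3) there is a linear map $S:H\to H$ (antipode) with $h_{(1)}S(h_{(2)})=(\varepsilon\otimes\mathrm{id})(\Delta(1)(h\otimes1))$, $S(h_{(1)})h_{(2)}=(\mathrm{id}\otimes\varepsilon)((1\otimes h)\Delta(1))$, $S(h_{(1)})h_{(2)}S(h_{(3)})=S(h)$, for all $h,g,f\in H$. *)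

(* Defs.v *)
From HB Require Import structures.
From mathcomp Require Import all_boot all_order all_algebra.
From mathcomp Require Import boolp classical_sets.

Set Implicit Arguments.
Unset Strict Implicit.
Unset Printing Implicit Defensive.

Import GRing.Theory.
Local Open Scope quotient_scope.
Local Open Scope ring_scope.

Section Tensor.
Variables (k : fieldType) (R : Type) (X Y : lmodType k).
Variables (ra : R -> X -> X) (la : R -> Y -> Y).

Definition balanced (Z : lmodType k) (f : X -> Y -> Z) : Prop :=
  [/\ forall y, linear (fun x => f x y),
      forall x, linear (f x)
    & forall r x y, f (ra r x) y = f x (la r y)].

Definition fsum (Z : zmodType) (f : X -> Y -> Z) (s : seq (X * Y)) : Z :=
  \sum_(p <- s) f p.1 p.2.

(* X (x)_R Y is the set of formal sums of pure tensors modulo the relation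
   "not distinguished by any k-bilinear R-balanced map"; see tensor_univ. *)
Definition teqv : rel (seq (X * Y)) := fun s t =>
  `[< forall (Z : lmodType k) (f : X -> Y -> Z),
        balanced f -> fsum f s = fsum f t >].

Lemma teqv_is_equiv : equiv_class_of teqv.
Proof.
split=> [s|s t|s t u]; first exact/asboolP.
- by apply/asboolP/asboolP=> h Z f bf; rewrite h.
- move=> /asboolP h1 /asboolP h2; apply/asboolP=> Z f bf.
  by rewrite h1 // h2.
Qed.

Canonical teqv_equiv := EquivRelPack teqv_is_equiv.

Definition tensor : Type := {eq_quot teqv}.
HB.instance Definition _ := EqQuotient.on tensor.
HB.instance Definition _ := Choice.on tensor.

Definition tpure (x : X) (y : Y) : tensor := \pi_tensor [:: (x, y)].

(* Sweedler-style evaluation: tsum f t is the sum of f t1 t2 over a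
   representative of t = t1 (x) t2; it is meaningful when f is balanced. *)
Definition tsum (Z : zmodType) (f : X -> Y -> Z) (t : tensor) : Z :=
  fsum f (repr t).

Lemma teqvP s t :
  reflect (forall (Z : lmodType k) (f : X -> Y -> Z),
             balanced f -> fsum f s = fsum f t)
          (\pi_tensor s == \pi_tensor t).
Proof. by rewrite eqmodE; apply: asboolP. Qed.

Lemma tsum_pi (Z : lmodType k) (f : X -> Y -> Z) s :
  balanced f -> tsum f (\pi_tensor s) = fsum f s.
Proof.
move=> bf; rewrite /tsum.
have /eqP/teqvP : \pi_tensor (repr (\pi_tensor s)) = \pi_tensor s.
  by rewrite reprK.
by apply.
Qed.

Lemma fsum_cat (Z : zmodType) (f : X -> Y -> Z) s t :
  fsum f (s ++ t) = fsum f s + fsum f t.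
Proof. by rewrite /fsum big_cat. Qed.

Definition fscale (a : k) (s : seq (X * Y)) := [seq (a *: p.1, p.2) | p <- s].

Lemma fsum_scale (Z : lmodType k) (f : X -> Y -> Z) a s :
  balanced f -> fsum f (fscale a s) = a *: fsum f s.
Proof.
case=> fl _ _; rewrite /fsum big_map scaler_sumr.
apply: eq_bigr => p _ /=.
have := fl p.2 a p.1 0; rewrite addr0 => ->.
suff -> : f 0 p.2 = 0 by rewrite addr0.
by have /(congr1 (fun z => z - f 0 p.2)) := fl p.2 1 0 0;
  rewrite !scale1r addr0 addrK subrr.
Qed.

Definition tadd (s t : tensor) : tensor := \pi_tensor (repr s ++ repr t).
Definition tscale (a : k) (t : tensor) : tensor := \pi_tensor (fscale a (repr t)).
Definition topp (t : tensor) : tensor := tscale (-1) t.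
Definition tzero : tensor := \pi_tensor [::].

Lemma tensor_ext (s t : tensor) :
  (forall (Z : lmodType k) (f : X -> Y -> Z),
     balanced f -> tsum f s = tsum f t) -> s = t.
Proof.
move=> h; rewrite -[s]reprK -[t]reprK; apply/eqP/teqvP => Z f bf.
exact: h.
Qed.

Lemma tsumD (Z : lmodType k) (f : X -> Y -> Z) s t :
  balanced f -> tsum f (tadd s t) = tsum f s + tsum f t.
Proof. by move=> bf; rewrite tsum_pi // fsum_cat. Qed.

Lemma tsumZ (Z : lmodType k) (f : X -> Y -> Z) a t :
  balanced f -> tsum f (tscale a t) = a *: tsum f t.
Proof. by move=> bf; rewrite tsum_pi // fsum_scale. Qed.

Lemma tsum0 (Z : lmodType k) (f : X -> Y -> Z) :
  balanced f -> tsum f tzero = 0.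
Proof. by move=> bf; rewrite tsum_pi // /fsum big_nil. Qed.

Lemma taddA : associative tadd.
Proof. by move=> s t u; apply: tensor_ext => Z f bf; rewrite !tsumD // addrA. Qed.

Lemma taddC : commutative tadd.
Proof. by move=> s t; apply: tensor_ext => Z f bf; rewrite !tsumD // addrC. Qed.

Lemma tadd0 : left_id tzero tadd.
Proof. by move=> s; apply: tensor_ext => Z f bf; rewrite tsumD // tsum0 // add0r. Qed.

Lemma taddN : left_inverse tzero topp tadd.
Proof.
by move=> s; apply: tensor_ext => Z f bf;
  rewrite tsumD // tsumZ // tsum0 // scaleN1r addNr.
Qed.

HB.instance Definition _ := GRing.isZmodule.Build tensor taddA taddC tadd0 taddN.

Lemma tscaleA a b v : tscale a (tscale b v) = tscale (a * b) v.
Proof. by apply: tensor_ext => Z f bf; rewrite !tsumZ // scalerA. Qed.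

Lemma tscale1 : left_id 1 tscale.
Proof. by move=> v; apply: tensor_ext => Z f bf; rewrite !tsumZ // scale1r. Qed.

Lemma tscaleDr : right_distributive tscale +%R.
Proof.
move=> a u v; apply: tensor_ext => Z f bf.
by rewrite tsumZ // !tsumD // !tsumZ // scalerDr.
Qed.

Lemma tscaleDl v : {morph tscale^~ v: a b / a + b}.
Proof.
move=> a b; apply: tensor_ext => Z f bf.
by rewrite tsumD // !tsumZ // scalerDl.
Qed.

HB.instance Definition _ :=
  GRing.Zmodule_isLmodule.Build k tensor tscaleA tscale1 tscaleDr tscaleDl.

Lemma tsum_linear (Z : lmodType k) (f : X -> Y -> Z) :
  balanced f -> linear (tsum f).
Proof. by move=> bf a s t; rewrite tsumD // tsumZ. Qed.

Lemma tsumE (Z : lmodType k) (f : X -> Y -> Z) x y :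
  balanced f -> tsum f (tpure x y) = f x y.
Proof. by move=> bf; rewrite tsum_pi // /fsum big_seq1. Qed.

Lemma tpure_balanced : balanced tpure.
Proof.
split=> [y a x x'|x a y y'|r x y]; apply: tensor_ext => Z f bf;
  rewrite ?(tsum_linear bf) !tsumE //; case: bf => h1 h2 h3.
- by rewrite h1.
- by rewrite h2.
- by rewrite h3.
Qed.

Lemma tensorE (t : tensor) : t = tsum tpure t.
Proof.
rewrite -{1}[t]reprK /tsum; elim: (repr t) => [|[x y] s IHs].
  by rewrite /fsum big_nil.
rewrite /fsum big_cons -/(fsum tpure s) -IHs.
apply: tensor_ext => Z f bf.
by rewrite tsumD // tsumE // !tsum_pi // /fsum big_cons.
Qed.

Lemma tensor_univ (Z : lmodType k) (f : X -> Y -> Z) : balanced f ->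
  exists! g : tensor -> Z,
    linear g /\ forall x y, g (tpure x y) = f x y.
Proof.
move=> bf; exists (tsum f); split.
  by split; [exact: tsum_linear | move=> x y; rewrite tsumE].
move=> g [gl gE]; apply/funext => t; rewrite [in RHS](tensorE t).
pose g' : {linear tensor -> Z} := HB.pack g (GRing.isLinear.Build _ _ _ _ g gl).
rewrite -[g]/(g' : _ -> _) /tsum /fsum raddf_sum.
by apply: eq_bigr => p _; rewrite /= gE.
Qed.

End Tensor.

Definition dual_bases (k : fieldType) (N M : algType k) (i : N -> M)
    (E : M -> N) (s : seq (M * M)) : Prop :=
  forall m : M, \sum_(p <- s) i (E (m * p.1)) * p.2 = m
             /\ \sum_(p <- s) p.1 * i (E (p.2 * m)) = m.

(* M/N is given by a structure map fincl : N -> M; it is injective as soon as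
   fE 1 = 1. The dual bases are the pairs listed in fdual. *)
Record frobenius_ext (k : fieldType) := FrobeniusExt {
  fsub : algType k;
  fext : algType k;
  fincl : {lrmorphism fsub -> fext};
  fE : {linear fext -> fsub};
  fE_bimod : forall n m n', fE (fincl n * m * fincl n') = n * fE m * n';
  fdual : seq (fext * fext);
  fdualP : dual_bases fincl fE fdual
}.

Section BasicConstruction.
Variables (k : fieldType) (F : frobenius_ext k).
Local Notation M := (fext F).
Local Notation i := (fincl F).
Local Notation E := (fE F).
Local Notation bra := (fun (n : fsub F) (m : M) => m * i n).
Local Notation bla := (fun (n : fsub F) (m : M) => i n * m).
Local Notation bsum f t := (@tsum k (fsub F) M M bra bla _ f t).

Definition basic : Type :=
  @tensor k (fsub F) M M bra bla.
HB.instance Definition _ := GRing.Lmodule.on basic.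

(* bpure m m' is the element m e_1 m' of M (x)_N M. *)
Definition bpure (m m' : M) : basic := tpure _ _ m m'.
Definition be : basic := bpure 1 1.
Definition bone : basic := \sum_(p <- fdual F) bpure p.1 p.2.
Definition bmul (s t : basic) : basic :=
  bsum (fun m m' => bsum (fun n n' => bpure (m * i (E (m' * n))) n') t) s.

Lemma bpureB : balanced bra bla bpure.
Proof. exact: tpure_balanced. Qed.

Lemma bpureDl x x' y : bpure (x + x') y = bpure x y + bpure x' y.
Proof. by have [h _ _] := bpureB; have := h y 1 x x'; rewrite !scale1r. Qed.

Lemma bpureZl a x y : bpure (a *: x) y = a *: bpure x y.
Proof.
have [h _ _] := bpureB; have h0 : bpure 0 y = 0.
  by apply: (addIr (bpure 0 y)); rewrite -bpureDl !add0r.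
by have := h y a x 0; rewrite !addr0 h0 addr0.
Qed.

Lemma bpureDr x y y' : bpure x (y + y') = bpure x y + bpure x y'.
Proof. by have [_ h _] := bpureB; have := h x 1 y y'; rewrite !scale1r. Qed.

Lemma bpureZr a x y : bpure x (a *: y) = a *: bpure x y.
Proof.
have [_ h _] := bpureB; have h0 : bpure x 0 = 0.
  by apply: (addIr (bpure x 0)); rewrite -bpureDr !add0r.
by have := h x a y 0; rewrite !addr0 h0 addr0.
Qed.

Lemma bpureM x n y : bpure (x * i n) y = bpure x (i n * y).
Proof. by have [_ _ h] := bpureB; apply: h. Qed.

Lemma bpure_suml (I : Type) (s : seq I) (f : I -> M) y :
  bpure (\sum_(j <- s) f j) y = \sum_(j <- s) bpure (f j) y.
Proof.
elim/big_rec2: _ => [|j _ u _ <-]; last by rewrite bpureDl.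
by rewrite -(scale0r 0) bpureZl scale0r.
Qed.

Lemma bpure_sumr (I : Type) (s : seq I) (f : I -> M) x :
  bpure x (\sum_(j <- s) f j) = \sum_(j <- s) bpure x (f j).
Proof.
elim/big_rec2: _ => [|j _ u _ <-]; last by rewrite bpureDr.
by rewrite -(scale0r 0) bpureZr scale0r.
Qed.

Lemma E_bimodl n m : E (i n * m) = n * E m.
Proof. by have := fE_bimod n m 1; rewrite rmorph1 !mulr1. Qed.

Lemma E_bimodr m n : E (m * i n) = E m * n.
Proof. by have := fE_bimod 1 m n; rewrite rmorph1 !mul1r. Qed.

Lemma bmul_inner m m' : balanced bra bla
  (fun n n' => bpure (m * i (E (m' * n))) n').
Proof.
split=> [y a x x'|x a y y'|r x y].
- by rewrite mulrDr -scalerAr !linearP mulrDr -scalerAr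
             bpureDl bpureZl.
- by rewrite bpureDr bpureZr.
- by rewrite /= mulrA E_bimodr rmorphM mulrA -bpureM.
Qed.

Lemma bmul_outer t : balanced bra bla
  (fun m m' => bsum (fun n n' => bpure (m * i (E (m' * n))) n') t).
Proof.
split=> [y a x x'|x a y y'|r x y]; rewrite /tsum /fsum.
- rewrite scaler_sumr -big_split; apply: eq_bigr => p _ /=.
  by rewrite mulrDl -scalerAl bpureDl bpureZl.
- rewrite scaler_sumr -big_split; apply: eq_bigr => p _ /=.
  by rewrite mulrDl -scalerAl !linearP mulrDr -scalerAr
             bpureDl bpureZl.
- apply: eq_bigr => p _ /=.
  by rewrite -!mulrA E_bimodl rmorphM.
Qed.

Lemma bmulE m m' n n' :
  bmul (bpure m m') (bpure n n') = bpure (m * i (E (m' * n))) n'.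
Proof.
rewrite /bmul (tsumE _ _ (bmul_outer _)).
by rewrite (tsumE _ _ (bmul_inner _ _)).
Qed.

Lemma bmulPl a s s' t : bmul (a *: s + s') t = a *: bmul s t + bmul s' t.
Proof. exact: tsum_linear (bmul_outer t) a s s'. Qed.

Lemma bmulPr a s t t' : bmul s (a *: t + t') = a *: bmul s t + bmul s t'.
Proof.
rewrite /bmul {1 2 3}/tsum /fsum scaler_sumr -big_split.
by apply: eq_bigr => p _; apply: (tsum_linear (bmul_inner p.1 p.2)).
Qed.

Lemma bmulDl : left_distributive bmul +%R.
Proof. by move=> s s' t; have := bmulPl 1 s s' t; rewrite !scale1r. Qed.

Lemma bmulDr : right_distributive bmul +%R.
Proof. by move=> s t t'; have := bmulPr 1 s t t'; rewrite !scale1r. Qed.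

Lemma bmul0 s : bmul s 0 = 0.
Proof. by apply: (addIr (bmul s 0)); rewrite -bmulDr !add0r. Qed.

Lemma b0mul s : bmul 0 s = 0.
Proof. by apply: (addIr (bmul 0 s)); rewrite -bmulDl !add0r. Qed.

Lemma bmulZl a s t : bmul (a *: s) t = a *: bmul s t.
Proof. by have := bmulPl a s 0 t; rewrite b0mul !addr0. Qed.

Lemma bmulZr a s t : bmul s (a *: t) = a *: bmul s t.
Proof. by have := bmulPr a s t 0; rewrite bmul0 !addr0. Qed.

Lemma bind (P : basic -> Prop) :
  P 0 -> (forall m m' t, P t -> P (bpure m m' + t)) -> forall t, P t.
Proof.
move=> P0 PD t; rewrite (tensorE t) /tsum /fsum.
by elim/big_rec: _ => // p x _ Px; apply: PD.
Qed.

Lemma bmulA : associative bmul.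
Proof.
move=> s t u.
elim/bind: s => [|m m' s IHs]; first by rewrite !b0mul.
rewrite !bmulDl IHs; congr (_ + _).
clear s IHs; elim/bind: t => [|n n' t IHt]; first by rewrite b0mul bmul0 b0mul.
rewrite [bmul (_ + t) u]bmulDl !bmulDr [RHS]bmulDl IHt; congr (_ + _).
clear t IHt; elim/bind: u => [|q q' u IHu]; first by rewrite !bmul0.
rewrite !bmulDr IHu; congr (_ + _).
by rewrite !bmulE mulrA E_bimodr rmorphM mulrA.
Qed.

Lemma bmul_sumr (I : Type) (r : seq I) (f : I -> basic) s :
  bmul s (\sum_(j <- r) f j) = \sum_(j <- r) bmul s (f j).
Proof. by elim/big_rec2: _ => [|j _ u _ <-]; rewrite ?bmul0 ?bmulDr. Qed.

Lemma bmul_suml (I : Type) (r : seq I) (f : I -> basic) s :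
  bmul (\sum_(j <- r) f j) s = \sum_(j <- r) bmul (f j) s.
Proof. by elim/big_rec2: _ => [|j _ u _ <-]; rewrite ?b0mul ?bmulDl. Qed.

Lemma bmul1 : right_id bone bmul.
Proof.
elim/bind => [|m m' s IHs]; first by rewrite b0mul.
rewrite bmulDl IHs /bone bmul_sumr; congr (_ + _).
rewrite -[in RHS](fdualP m').1 bpure_sumr; apply: eq_bigr => p _.
by rewrite bmulE bpureM.
Qed.

Lemma b1mul : left_id bone bmul.
Proof.
elim/bind => [|m m' s IHs]; first by rewrite bmul0.
rewrite bmulDr IHs /bone bmul_suml; congr (_ + _).
rewrite -[in RHS](fdualP m).2 bpure_suml; apply: eq_bigr => p _.
by rewrite bmulE.
Qed.

Lemma bact_balanced : balanced bra bla
  (fun m m' => m * i (E m')).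
Proof.
split=> [y a x x'|x a y y'|r x y].
- by rewrite mulrDl -scalerAl.
- by rewrite !linearP mulrDr -scalerAr.
- by rewrite E_bimodl rmorphM mulrA.
Qed.

Lemma bone_neq0 : bone != 0.
Proof.
apply/eqP => b0; have := (fdualP (1 : M)).2.
pose g0 : basic -> M := @tsum k (fsub F) M M bra bla M (fun m m' => m * i (E m')).
have tl : linear g0 := tsum_linear bact_balanced.
pose g : {linear basic -> M} := HB.pack g0 (GRing.isLinear.Build _ _ _ _ _ tl).
have : g bone = 0 by rewrite b0 raddf0.
rewrite raddf_sum /= => h.
under eq_bigr => p _ do rewrite mulr1.
move=> h1; case/eqP: (oner_neq0 M); rewrite -h1 -[RHS]h.
by apply: eq_bigr => p _; apply: esym; apply: (tsumE _ _ bact_balanced).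
Qed.

HB.instance Definition _ := GRing.Zmodule_isNzRing.Build basic
  bmulA b1mul bmul1 bmulDl bmulDr bone_neq0.

Lemma basic_scalerAl a (s t : basic) : a *: (s * t) = (a *: s) * t.
Proof. by rewrite -[RHS]/(bmul _ _) bmulZl. Qed.

Lemma basic_scalerAr a (s t : basic) : a *: (s * t) = s * (a *: t).
Proof. by rewrite -[RHS]/(bmul _ _) bmulZr. Qed.

HB.instance Definition _ :=
  GRing.Lmodule_isLalgebra.Build k basic basic_scalerAl.
HB.instance Definition _ :=
  GRing.Lalgebra_isAlgebra.Build k basic basic_scalerAr.

Lemma bpure_mul m m' n n' :
  bpure m m' * bpure n n' = bpure (m * i (E (m' * n))) n' :> basic.
Proof. exact: bmulE. Qed.

Lemma sum_bpure_ind (P : basic -> Prop) :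
  P 0 -> (forall s t, P s -> P t -> P (s + t)) ->
  (forall m m', P (bpure m m')) -> forall t, P t.
Proof. by move=> P0 PD Pp; elim/bind => // m m' t; apply: PD. Qed.

Definition bincl (m : M) : basic := \sum_(p <- fdual F) bpure (m * p.1) p.2.

Lemma binclMl m a b : bincl m * bpure a b = bpure (m * a) b.
Proof.
rewrite /bincl mulr_suml -[in RHS](fdualP a).2 mulr_sumr bpure_suml.
by apply: eq_bigr => p _; rewrite bpure_mul mulrA.
Qed.

Lemma bmulincl m a b : bpure a b * bincl m = bpure a (b * m).
Proof.
rewrite /bincl mulr_sumr -[in RHS](fdualP (b * m)).1 bpure_sumr.
by apply: eq_bigr => p _; rewrite bpure_mul bpureM mulrA.
Qed.

Lemma bincl_linear : linear bincl.
Proof.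
move=> a m m'; rewrite /bincl scaler_sumr -big_split.
by apply: eq_bigr => p _; rewrite mulrDl -scalerAl bpureDl bpureZl.
Qed.

Lemma bincl_monoid : monoid_morphism bincl.
Proof.
split=> [|m m'].
  by apply: eq_bigr => p _; rewrite mul1r.
rewrite {3}/bincl mulr_sumr; apply: eq_bigr => p _.
by rewrite binclMl mulrA.
Qed.

HB.instance Definition _ := GRing.isLinear.Build k M basic _ bincl bincl_linear.
HB.instance Definition _ := GRing.isMonoidMorphism.Build M basic bincl bincl_monoid.

Section Expectation.
Variable lam : k.

Definition bE (t : basic) : M := bsum (fun m m' => lam *: (m * m')) t.

Lemma bE_balanced : balanced bra bla (fun m m' => lam *: (m * m')).
Proof.
split=> [y a x x'|x a y y'|r x y].
- by rewrite mulrDl -scalerAl scalerDr scalerA mulrC -scalerA.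
- by rewrite mulrDr -scalerAr scalerDr scalerA mulrC -scalerA.
- by rewrite mulrA.
Qed.

Lemma bE_linear : linear bE.
Proof. exact: tsum_linear bE_balanced. Qed.

HB.instance Definition _ := GRing.isLinear.Build k basic M _ bE bE_linear.

Lemma bE_pure m m' : bE (bpure m m') = lam *: (m * m').
Proof. exact: tsumE bE_balanced. Qed.

Lemma bE_bimod n m n' : bE (bincl n * m * bincl n') = n * bE m * n'.
Proof.
elim/sum_bpure_ind: m => [|s t IHs IHt|m m'].
- by rewrite !(mulr0, mul0r, raddf0).
- by rewrite !(mulrDr, mulrDl, raddfD) /= IHs IHt.
- by rewrite binclMl bmulincl !bE_pure -scalerAr -scalerAl !mulrA.
Qed.

Hypothesis lam_neq0 : lam != 0.

Definition bdual : seq (basic * basic) :=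
  [seq (lam^-1 *: bpure p.1 1, bpure 1 p.2) | p <- fdual F].

Lemma bdualP : dual_bases bincl bE bdual.
Proof.
move=> m; split; elim/sum_bpure_ind: m => [|s t IHs IHt|a b].
- by rewrite big1 // => p _; rewrite mul0r !raddf0 mul0r.
- rewrite -[in RHS]IHs -[in RHS]IHt -big_split; apply: eq_bigr => p _ /=.
  by rewrite mulrDl !raddfD mulrDl.
- rewrite big_map -[in RHS](fdualP b).1 bpure_sumr.
  apply: eq_bigr => p _ /=.
  rewrite -scalerAr linearZ /= bpure_mul bE_pure scalerA mulVf // scale1r mulr1.
  by rewrite binclMl mulr1 bpureM.
- by rewrite big1 // => p _; rewrite mulr0 !raddf0 mulr0.
- rewrite -[in RHS]IHs -[in RHS]IHt -big_split; apply: eq_bigr => p _ /=.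
  by rewrite mulrDr !raddfD mulrDr.
- rewrite big_map -[in RHS](fdualP a).2 bpure_suml.
  apply: eq_bigr => p _ /=.
  rewrite bpure_mul bE_pure mul1r linearZ /= -scalerAl -scalerAr scalerA.
  by rewrite mulVf // scale1r bmulincl mul1r bpureM.
Qed.

Definition basic_ext : frobenius_ext k :=
  @FrobeniusExt k M basic bincl bE bE_bimod bdual bdualP.

End Expectation.
End BasicConstruction.

Definition ktensor (k : fieldType) (X Y : lmodType k) : Type :=
  @tensor k k X Y *:%R *:%R.

Section KTensor.
Variables (k : fieldType) (X Y : lmodType k).
HB.instance Definition _ := GRing.Lmodule.on (ktensor X Y).

Definition kpure (x : X) (y : Y) : ktensor X Y := tpure _ _ x y.
Definition ksum (Z : zmodType) (f : X -> Y -> Z) (t : ktensor X Y) : Z :=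
  tsum f t.

Definition kmul (mX : X -> X -> X) (mY : Y -> Y -> Y)
    (s t : ktensor X Y) : ktensor X Y :=
  ksum (fun a b => ksum (fun c d => kpure (mX a c) (mY b d)) t) s.
End KTensor.

Section WeakHopf.
Variables (k : fieldType) (H : algType k).
Local Notation HH := (ktensor H H).
Local Notation HHH := (ktensor (ktensor H H) H).

Definition mul2 : HH -> HH -> HH := kmul *%R *%R.
Definition mul3 : HHH -> HHH -> HHH := kmul mul2 *%R.
Definition kassoc : ktensor H HH -> HHH :=
  ksum (fun a t => ksum (fun b c => kpure (kpure a b) c) t).

Lemma mul2_pure a b c d : mul2 (kpure a b) (kpure c d) = kpure (a * c) (b * d).
Proof.
have [pl pr pm] := tpure_balanced (fun (c : k) (x : H) => c *: x)
                                 (fun (c : k) (x : H) => c *: x).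
have inner a' b' : balanced (fun (c : k) (x : H) => c *: x)
    (fun (c : k) (x : H) => c *: x)
    (fun c d : H => kpure (a' * c) (b' * d)).
  split=> [y e x x'|x e y y'|r x y].
  - by rewrite mulrDr -scalerAr; apply: pl.
  - by rewrite mulrDr -scalerAr; apply: pr.
  - by rewrite -!scalerAr; apply: pm.
rewrite /mul2 /kmul /ksum tsumE; first by rewrite tsumE.
set t := kpure c d; split=> [y e x x'|x e y y'|r x y]; rewrite /tsum /fsum.
- rewrite scaler_sumr -big_split; apply: eq_bigr => p _ /=.
  by rewrite mulrDl -scalerAl; apply: pl.
- rewrite scaler_sumr -big_split; apply: eq_bigr => p _ /=.
  by rewrite mulrDl -scalerAl; apply: pr.
- apply: eq_bigr => p _ /=.
  by rewrite -!scalerAl; apply: pm.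
Qed.

Variables (Delta : H -> HH) (eps : H -> k) (S : H -> H).

Definition Delta_id : HH -> HHH := ksum (fun a b => kpure (Delta a) b).
Definition id_Delta : HH -> HHH := fun t =>
  kassoc (ksum (fun a b => kpure a (Delta b)) t).
Definition eps_id : HH -> H := ksum (fun a b => eps a *: b).
Definition id_eps : HH -> H := ksum (fun a b => eps b *: a).

Record coalgebra : Prop := Coalgebra {
  Delta_linear : linear Delta;
  eps_linear : scalar eps;
  coassociative : forall h, Delta_id (Delta h) = id_Delta (Delta h);
  counit_left : forall h, eps_id (Delta h) = h;
  counit_right : forall h, id_eps (Delta h) = h
}.

Record weak_hopf_algebra : Prop := WeakHopfAlgebra {
  wha_coalgebra : coalgebra;
  Delta_mul : forall h g, Delta (h * g) = mul2 (Delta h) (Delta g);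
  eps_mul12 : forall h g f,
    eps (h * g * f) = ksum (fun g1 g2 => eps (h * g1) * eps (g2 * f)) (Delta g);
  eps_mul21 : forall h g f,
    eps (h * g * f) = ksum (fun g1 g2 => eps (h * g2) * eps (g1 * f)) (Delta g);
  Delta_one12 :
    Delta_id (Delta 1) = mul3 (kpure (Delta 1) 1) (kassoc (kpure 1 (Delta 1)));
  Delta_one21 :
    Delta_id (Delta 1) = mul3 (kassoc (kpure 1 (Delta 1))) (kpure (Delta 1) 1);
  antipode_linear : linear S;
  antipode_right : forall h,
    ksum (fun h1 h2 => h1 * S h2) (Delta h)
    = eps_id (mul2 (Delta 1) (kpure h 1));
  antipode_left : forall h,
    ksum (fun h1 h2 => S h1 * h2) (Delta h)
    = id_eps (mul2 (kpure 1 h) (Delta 1));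
  antipode_mid : forall h,
    ksum (fun t h3 => ksum (fun h1 h2 => S h1 * h2 * S h3) t)
         (Delta_id (Delta h)) = S h
}.
End WeakHopf.

Section Algebras.
Variables (k : fieldType) (H : algType k).

Definition left_ideal (I : set H) : Prop :=
  [/\ I 0, forall x y, I x -> I y -> I (x + y) & forall h x, I x -> I (h * x)].

(* H is semisimple as a left module over itself. *)
Definition semisimple : Prop :=
  forall I : set H, left_ideal I ->
  exists2 J : set H, left_ideal J &
    (forall x, I x -> J x -> x = 0) /\
    (forall h, exists x y, [/\ I x, J y & h = x + y]).

Definition symmetric_separability_element (f : ktensor H H) : Prop :=
  [/\ forall h, ksum (fun a b => kpure (h * a) b) f
              = ksum (fun a b => kpure a (b * h)) f,
      ksum (fun a b => a * b) f = 1
    & ksum (fun a b => kpure b a) f = f].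

Definition Kanzaki_separable : Prop :=
  exists f : ktensor H H, symmetric_separability_element f.

Definition is_trace (t : H -> k) : Prop :=
  scalar t /\ forall x y, t (x * y) = t (y * x).

Definition nondegenerate_trace (t : H -> k) : Prop :=
  is_trace t /\ forall x, (forall y, t (x * y) = 0) -> x = 0.
End Algebras.

Section Centralizer.
Variables (k : fieldType) (X : algType k) (Y : set X).

Definition centralizer_pred : {pred X} :=
  fun x => `[< forall y, Y y -> x * y = y * x >].

Lemma centralizerP x :
  reflect (forall y, Y y -> x * y = y * x) (x \in centralizer_pred).
Proof. exact: asboolP. Qed.

Lemma centralizer_subalg : subalg_closed centralizer_pred.
Proof.
split; first by apply/centralizerP => y _; rewrite mul1r mulr1.
- move=> a u v /centralizerP hu /centralizerP hv; apply/centralizerP => y Yy.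
  by rewrite mulrDl mulrDr -scalerAl -scalerAr hu // hv.
- move=> u v /centralizerP hu /centralizerP hv; apply/centralizerP => y Yy.
  by rewrite -mulrA hv // mulrA hu // mulrA.
Qed.

HB.instance Definition _ :=
  GRing.isSubalgClosed.Build k X centralizer_pred centralizer_subalg.

Definition centralizer : Type := {x : X | x \in centralizer_pred}.
HB.instance Definition _ := SubChoice.on centralizer.
HB.instance Definition _ := [SubChoice_isSubAlgebra of centralizer by <:].
End Centralizer.

Definition strongly_separable (k : fieldType) (F : frobenius_ext k) (lam : k) :=
  [/\ lam != 0, fE F 1 = 1
    & \sum_(p <- fdual F) p.1 * p.2 = lam^-1 *: 1].

Definition markov_ext (k : fieldType) (F : frobenius_ext k) (lam : k)
    (T : fsub F -> k) :=
  [/\ strongly_separable F lam, is_trace T, T 1 = 1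
    & is_trace (fun m => T (fE F m))].

Definition relative_centralizer (k : fieldType) (N M : algType k)
    (i : N -> M) : algType k := centralizer (range i).

Definition symmetric_markov_ext (k : fieldType) (F : frobenius_ext k) (lam : k)
    (T : fsub F -> k) :=
  markov_ext lam T /\
  forall (u : relative_centralizer (fincl F)) (x : fext F),
    fE F (val u * x) = fE F (x * val u).

Section JonesTower.
Variables (k : fieldType) (F : frobenius_ext k) (lam : k).
Hypothesis lam_neq0 : lam != 0.
Variable T : fsub F -> k.

Definition F1 : frobenius_ext k := basic_ext F lam_neq0.
Definition F2 : frobenius_ext k := basic_ext F1 lam_neq0.

Definition M1 : algType k := fext F1.
Definition M2 : algType k := fext F2.
Definition i1 : {lrmorphism fext F -> M1} := fincl F1.
Definition i2 : {lrmorphism M1 -> M2} := fincl F2.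
Definition e1 : M1 := be F.
Definition e2 : M2 := be F1.

Definition T0 (m : fext F) : k := T (fE F m).
Definition T1 (x : M1) : k := T0 (fE F1 x).
Definition T2 (x : M2) : k := T1 (fE F2 x).

Definition centU : algType k := relative_centralizer (fincl F).
Definition centV : algType k := relative_centralizer i1.
Definition centA : algType k := relative_centralizer (i1 \o fincl F).
Definition centB : algType k := relative_centralizer (i2 \o i1).

Definition phi (u : centU) : M1 :=
  \sum_(p <- fdual F) bpure (p.1 * val u) p.2.

(* Either form of the hypothesis is admitted; x_i y_i = lam^-1 1 is already
   part of strongly_separable. *)
Definition symmetric_product : Prop :=
  \sum_(p <- fdual F) p.2 * p.1 = lam^-1 *: 1
  \/ forall u : centU, T0 (val u) = T1 (phi u).

Definition weakly_irreducible : Prop :=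
  Kanzaki_separable centU /\ nondegenerate_trace (fun u : centU => T0 (val u)).

Definition depth2 : Prop :=
  (exists s : seq (centA * centA),
     dual_bases (fincl F1) (fE F1) [seq (val p.1, val p.2) | p <- s]) /\
  (exists s : seq (centB * centB),
     dual_bases (fincl F2) (fE F2) [seq (val p.1, val p.2) | p <- s]).

(* The elements f, w, Delta b and S b are characterised by a unique-existence
   property; xget selects the element with that property (and would return the
   given default if there were none). *)
Definition sep_elt : ktensor centV centV :=
  xget 0 [set f | symmetric_separability_element f].

Definition w_inv : centV := ksum (fun a b : centV => T2 (i2 (val b)) *: a) sep_elt.
Definition w_elt : centV := xget 0 [set v | v * w_inv = 1 /\ w_inv * v = 1].

Definition pairing (a : centA) (b : centB) : k :=
  lam ^- 2 * T2 (i2 (val a) * e2 * i2 e1 * i2 (val w_elt) * val b).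
Definition pairing' (a : centA) (b : centB) : k :=
  lam ^- 2 * T2 (val b * i2 e1 * e2 * i2 (val w_elt) * i2 (val a)).

Definition B_comul (b : centB) : ktensor centB centB :=
  xget 0 [set t | forall a1 a2 : centA,
    ksum (fun b1 b2 => pairing a1 b1 * pairing a2 b2) t = pairing (a1 * a2) b].
Definition B_counit (b : centB) : k := pairing 1 b.
Definition B_antipode (b : centB) : centB :=
  xget 0 [set b' | forall a : centA, pairing a b = pairing' a b'].
End JonesTower.

Arguments B_comul {k F lam} lam_neq0 T b.
Arguments B_counit {k F lam} lam_neq0 T b.
Arguments B_antipode {k F lam} lam_neq0 T b.

(* Main.v *)
Require Import Defs.
From HB Require Import structures.
From mathcomp Require Import all_boot all_order all_algebra.
From mathcomp Require Import boolp classical_sets.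

Set Implicit Arguments.
Unset Strict Implicit.
Unset Printing Implicit Defensive.

Import GRing.Theory.
Local Open Scope ring_scope.

(** Let [b ▷ x = lam^-1 E(b x e2)] and [x ◁ b = lam^-1 E(e2 x b)] be the
    left and right actions of [M2] on [M1], with [E = E_M1].  They satisfy
    [b x e2 = (b ▷ x) e2] and [e2 x b = e2 (x ◁ b)], they are faithful, they
    are adjoint for the trace form of [M1], and [B] acts by [M]-bimodule maps.
    As [M1] is generated by [e1] as an [M]-bimodule, an element of [B] is
    determined by its value on [e1]; by depth 2 every element of
    [A = C_M1(N)] is such a value ([act_e1_onto]).

    The pairing is [<a,b> = epsA(b ▷ a)] with [epsA(x) = lam^-1 T(x e1 w)],
    and [<beta ▷ e1, b> = T(b beta w)].  So dual bases of the trace of [B],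
    made of those of [E] and of those of the trace of [V], give dual bases of
    the pairing ([dpair_basis]), and the coalgebra [B] is the dual of the
    algebra [A].

    Two formulas describe how [B] moves past [M1].  The first is
    [b x = (b1 ▷ x) b2], that is [b ▷ (x y) = (b1 ▷ x) (b2 ▷ y)]
    ([comul_act]).  Some elements [b1], [b2] with this property exist because
    [b e1] lies in [A B] and [A = B ▷ e1]; inserting the separability element
    of [V] between them, they pair with a product as [Delta b] must, by
    [epsA(x y) = epsA(x f1) epsA(f2 y)] ([epsA_mul]), and nondegeneracy
    identifies them with [Delta b].  Multiplicativity of [Delta] and the
    axioms on the counit and on [Delta 1] follow by pairing.  The second is
    [x b = w b2 w^-1 (x ◁ b1)] ([comul_ract]); it is read off from the
    dual bases of the pairing.

    The definition of the antipode amounts to [S(b) ▷ x = ((x w) ◁ b) w^-1].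
    Up to the factors [w] the antipode is the adjoint for the trace form,
    so [T((h1 S(h2) ▷ x) y)] and [T((S(h1) h2 ▷ x) y)] are computed by the
    second and the first formula, and give the two antipode identities
    ([comul_antipode_r], [comul_antipode_l]); the third one follows from these.

    Finally the separability element of [V] and the dual bases of [E], whose
    index [lam^-1] is invertible, combine into a separability element of [B],
    and [B] is semisimple by Maschke's averaging. *)

(** * Tensors over the ground field *)

Section LinearPredicate.
Variables (k : fieldType) (X Z : lmodType k).

Lemma linear_add (f : X -> Z) : linear f -> {morph f : x y / x + y}.
Proof. by move=> lf x y; have := lf 1 x y; rewrite !scale1r. Qed.

Lemma linear_zero (f : X -> Z) : linear f -> f 0 = 0.
Proof. by move=> lf; apply: (addIr (f 0)); rewrite -linear_add // !add0r. Qed.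

Lemma linear_scale (f : X -> Z) a x : linear f -> f (a *: x) = a *: f x.
Proof. by move=> lf; have := lf a x 0; rewrite linear_zero // !addr0. Qed.

Lemma linear_sub (f : X -> Z) x y : linear f -> f (x - y) = f x - f y.
Proof. by move=> lf; rewrite linear_add // -scaleN1r linear_scale // scaleN1r. Qed.

Lemma linear_bigsum (I : Type) (f : X -> Z) (s : seq I) (g : I -> X) :
  linear f -> f (\sum_(i <- s) g i) = \sum_(i <- s) f (g i).
Proof. by move=> lf; apply: (big_morph f (linear_add lf) (linear_zero lf)). Qed.

End LinearPredicate.

Section Bilinear.
Variables (k : fieldType) (X Y Z : lmodType k).

Definition bilin (G : X -> Y -> Z) :=
  (forall y, linear (fun x => G x y)) /\ (forall x, linear (G x)).

Lemma bilin_balanced (G : X -> Y -> Z) : bilin G -> balanced *:%R *:%R G.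
Proof.
case=> Gl Gr; split=> // r x y.
by rewrite (linear_scale _ _ (Gl y)) (linear_scale _ _ (Gr x)).
Qed.

End Bilinear.

Section TensorTools.
Variables (k : fieldType) (X Y : lmodType k).
Implicit Types (t : ktensor X Y) (Z : lmodType k).

Lemma kpure_bilin : bilin (@kpure k X Y).
Proof.
have [Gl Gr _] := tpure_balanced (fun (c : k) (x : X) => c *: x)
                                 (fun (c : k) (y : Y) => c *: y).
by split.
Qed.

Lemma ksum_linear Z (G : X -> Y -> Z) : bilin G -> linear (ksum G).
Proof. by move=> /bilin_balanced bG; apply: tsum_linear bG. Qed.

Lemma ksum_pure Z (G : X -> Y -> Z) x y : bilin G -> ksum G (kpure x y) = G x y.
Proof. by move=> /bilin_balanced bG; apply: tsumE bG. Qed.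

Lemma ktensorE t : t = \sum_(p <- repr t) kpure p.1 p.2.
Proof. by rewrite {1}[t]tensorE. Qed.

Lemma ksum_seq Z (G : X -> Y -> Z) (s : seq (X * Y)) : bilin G ->
  ksum G (\sum_(p <- s) kpure p.1 p.2) = \sum_(p <- s) G p.1 p.2.
Proof.
move=> bG; rewrite (linear_bigsum _ _ (ksum_linear bG)).
by apply: eq_bigr => p _; rewrite ksum_pure.
Qed.

End TensorTools.

Lemma kmul_pure (k : fieldType) (X Y : lmodType k) (mX : X -> X -> X)
    (mY : Y -> Y -> Y) x y x' y' :
  bilin mX -> bilin mY ->
  kmul mX mY (kpure x y) (kpure x' y') = kpure (mX x x') (mY y y').
Proof.
move=> [mXl mXr] [mYl mYr]; have [Pl Pr] := kpure_bilin X Y.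
have inner u v : bilin (fun c d => kpure (mX u c) (mY v d)).
  by split=> ? a ? ?; rewrite ?mXr ?mYr ?Pl ?Pr.
rewrite /kmul ksum_pure ?ksum_pure //.
split=> ? a ? ?; rewrite /ksum /tsum /fsum scaler_sumr -big_split /=;
  by apply: eq_bigr => q _; rewrite ?mXl ?mYl ?Pl ?Pr.
Qed.

Lemma kmul_bilin (k : fieldType) (X Y : lmodType k) (mX : X -> X -> X)
    (mY : Y -> Y -> Y) :
  bilin mX -> bilin mY -> bilin (kmul mX mY).
Proof.
move=> [mXl mXr] [mYl mYr]; have [Pl Pr] := kpure_bilin X Y.
have inner u v : bilin (fun c d => kpure (mX u c) (mY v d)).
  by split=> ? a ? ?; rewrite ?mXr ?mYr ?Pl ?Pr.
split=> [t|s] a u v; last first.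
  rewrite /kmul {1 2 4}/ksum /tsum /fsum scaler_sumr -big_split /=.
  by apply: eq_bigr => p _; apply: (ksum_linear (inner p.1 p.2) a u v).
apply: (@ksum_linear _ _ _ _ (fun a b => ksum (fun c d => kpure (mX a c) (mY b d)) t)).
split=> ? ? ? ?; rewrite /ksum /tsum /fsum scaler_sumr -big_split /=;
  by apply: eq_bigr => q _; rewrite ?mXl ?mYl ?Pl ?Pr.
Qed.

Lemma mulr_bilin (k : fieldType) (H : algType k) : bilin (@GRing.mul H).
Proof. by split=> ? ? ? ?; rewrite ?mulrDl ?mulrDr -?scalerAl -?scalerAr. Qed.

Lemma mul2_bilin (k : fieldType) (H : algType k) : bilin (@mul2 k H).
Proof. exact: kmul_bilin (mulr_bilin H) (mulr_bilin H). Qed.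

Section Reassociation.
Variables (k : fieldType) (H : algType k).

Lemma kpure3_bilin (a : H) : bilin (fun b c : H => kpure (kpure a b) c).
Proof.
have [Pl Pr] := kpure_bilin (ktensor H H) H; have [_ pr] := kpure_bilin H H.
by split=> [c|b] x u v /=; rewrite ?pr ?Pl ?Pr.
Qed.

Let kassoc_bilin :
  bilin (fun (a : H) t => ksum (fun b c : H => kpure (kpure a b) c) t).
Proof.
have [Pl _] := kpure_bilin (ktensor H H) H; have [pl _] := kpure_bilin H H.
split=> [t|a] x u v; last by rewrite (ksum_linear (kpure3_bilin a)).
rewrite /ksum /tsum /fsum scaler_sumr -big_split; apply: eq_bigr => q _ /=.
by rewrite pl Pl.
Qed.

Lemma kassoc_pure (a : H) (t : ktensor H H) :
  kassoc (kpure a t) = ksum (fun b c => kpure (kpure a b) c) t.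
Proof. exact: ksum_pure kassoc_bilin. Qed.

Lemma id_DeltaE (Delta : H -> ktensor H H) (t : ktensor H H) :
  id_Delta Delta t = \sum_(p <- repr t) \sum_(q <- repr (Delta p.2))
                        kpure (kpure p.1 q.1) q.2.
Proof.
rewrite /id_Delta /kassoc {2}/ksum /tsum /fsum.
rewrite (linear_bigsum _ _ (ksum_linear kassoc_bilin)).
by apply: eq_bigr => p _; apply: kassoc_pure.
Qed.

End Reassociation.

(** * Centralizers as subalgebras *)

Section RelativeCentralizer.
Variables (k : fieldType) (N M : algType k) (i : N -> M).
Implicit Types c : relative_centralizer i.

Definition cincl c : M := val c.

Lemma cincl_comm c n : cincl c * i n = i n * cincl c.
Proof. by case: c => x xP; apply/(centralizerP _ _ xP); exists n. Qed.

Lemma cincl_inj : injective cincl.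
Proof. exact: val_inj. Qed.

Lemma cincl_onto (x : M) : (forall n, x * i n = i n * x) ->
  exists c, cincl c = x.
Proof.
move=> xC; have xP : x \in centralizer_pred (range i).
  by apply/centralizerP => _ [n _ <-].
by exists (exist _ x xP).
Qed.

Lemma cincl_linear : linear cincl.
Proof. by []. Qed.

Lemma cincl_monoid : monoid_morphism cincl.
Proof. by []. Qed.

HB.instance Definition _ :=
  GRing.isLinear.Build k (relative_centralizer i) M _ cincl cincl_linear.
HB.instance Definition _ :=
  GRing.isMonoidMorphism.Build (relative_centralizer i) M cincl cincl_monoid.

End RelativeCentralizer.

(** * Symmetric separability elements and non-degenerate traces *)

Section SeparabilityElement.
Variables (k : fieldType) (V : algType k).

Section Exchange.
Variables (f : ktensor V V) (fP : symmetric_separability_element f).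
Variables (Z : lmodType k) (G : V -> V -> Z).
Hypothesis bG : bilin G.

Let ksum_ext (g h : V -> V -> V * V) :
  ksum (fun a b => kpure (g a b).1 (g a b).2) f
    = ksum (fun a b => kpure (h a b).1 (h a b).2) f ->
  \sum_(p <- repr f) G (g p.1 p.2).1 (g p.1 p.2).2
    = \sum_(p <- repr f) G (h p.1 p.2).1 (h p.1 p.2).2.
Proof.
move=> /(congr1 (ksum G)); rewrite {2 4}/ksum /tsum /fsum.
rewrite !(linear_bigsum _ _ (ksum_linear bG)).
under eq_bigr do rewrite ksum_pure //.
by under [in RHS]eq_bigr do rewrite ksum_pure //.
Qed.

Lemma sep_flip :
  \sum_(p <- repr f) G p.1 p.2 = \sum_(p <- repr f) G p.2 p.1.
Proof.
case: fP => _ _ fF; apply/esym/(@ksum_ext (fun a b => (b, a)) (fun a b => (a, b))).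
by rewrite fF /= [LHS]ktensorE.
Qed.

Lemma sep_outer h :
  \sum_(p <- repr f) G (h * p.1) p.2 = \sum_(p <- repr f) G p.1 (p.2 * h).
Proof.
case: fP => fC _ _.
exact: (@ksum_ext (fun a b => (h * a, b)) (fun a b => (a, b * h)) (fC h)).
Qed.

End Exchange.

Lemma sep_one (f : ktensor V V) : symmetric_separability_element f ->
  \sum_(p <- repr f) p.1 * p.2 = 1.
Proof. by case. Qed.

(** Symmetry of [f] turns centrality for the outer factors into centrality for
    the inner ones. *)
Lemma sep_inner (f : ktensor V V) (Z : lmodType k) (G : V -> V -> Z) h :
  symmetric_separability_element f -> bilin G ->
  \sum_(p <- repr f) G (p.1 * h) p.2 = \sum_(p <- repr f) G p.1 (h * p.2).
Proof.
move=> fP [Gl Gr].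
rewrite (@sep_flip _ fP _ (fun a b => G (a * h) b)); last first.
  by split=> [?|?] ? ? ?; rewrite ?mulrDl -?scalerAl ?Gl ?Gr.
rewrite -(@sep_outer _ fP _ (fun a b => G b a)); last by split.
rewrite (@sep_flip _ fP _ (fun a b => G b (h * a))) //.
by split=> [?|?] ? ? ?; rewrite ?mulrDr -?scalerAr ?Gl ?Gr.
Qed.

Variables (t : V -> k) (tP : nondegenerate_trace t).

Lemma trace_linear : linear (t : V -> k^o).
Proof. by case: tP => -[]. Qed.

Lemma traceC x y : t (x * y) = t (y * x).
Proof. by case: tP => -[]. Qed.

Lemma trace_eq0 x : (forall y, t (x * y) = 0) -> x = 0.
Proof. by case: tP => _; apply. Qed.

Let tD : {morph t : x y / x + y} := linear_add trace_linear.
Let tB x y : t (x - y) = t x - t y := linear_sub x y trace_linear.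
Let tZ a x : t (a *: x) = a * t x := linear_scale a x trace_linear.
Let t_sum (I : Type) (s : seq I) (g : I -> V) :
  t (\sum_(i <- s) g i) = \sum_(i <- s) t (g i) :=
  linear_bigsum s g trace_linear.

(** Gram-Schmidt orthogonalisation for the trace form: a finite family of
    vectors has a finite family of coordinate functionals of the form
    [t (_ * z)]. *)
Lemma trace_coordinates (s : seq V) :
  exists L : seq (V * V),
    {in s, forall q, q = \sum_(l <- L) t (q * l.2) *: l.1}.
Proof.
elim: s => [|q s [L LP]]; first by exists [::].
pose Pi v := \sum_(l <- L) t (v * l.2) *: l.1.
have PiE v z : t (Pi v * z) = \sum_(l <- L) t (v * l.2) * t (l.1 * z).
  by rewrite mulr_suml t_sum; apply: eq_bigr => l _; rewrite -scalerAl tZ.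
have [qPi|qPi] := eqVneq q (Pi q).
  by exists L => x; rewrite inE => /orP[/eqP->|/LP].
have [z0 tz0] : exists z, t ((q - Pi q) * z) != 0.
  apply: contrapT => h; case/eqP: qPi; apply/eqP; rewrite -subr_eq0.
  apply/eqP/trace_eq0 => y.
  by apply: contrapT => ty; apply: h; exists y; apply/eqP.
pose z := (t ((q - Pi q) * z0))^-1 *: z0.
have tz : t ((q - Pi q) * z) = 1 by rewrite -scalerAr tZ mulVf.
pose z' := z - \sum_(l <- L) t (l.1 * z) *: l.2.
have tz' v : t (v * z') = t ((v - Pi v) * z).
  rewrite mulrBr tB mulrBl tB PiE mulr_sumr t_sum; congr (_ - _).
  by apply: eq_bigr => l _; rewrite -scalerAr tZ mulrC.
exists ((q - Pi q, z') :: L) => x; rewrite inE => /orP[/eqP->|xs];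
  rewrite big_cons /= tz'.
- by rewrite tz scale1r subrK.
- have PiK : Pi x = x by rewrite [RHS]LP.
  by rewrite -/(Pi x) PiK subrr mul0r (linear_zero trace_linear) scale0r add0r.
Qed.

Variables (f : ktensor V V) (fP : symmetric_separability_element f).

(** Dual bases for the trace: with [q] expanded in its coordinates
    [t (q * z_a)], moving [v] through [f] in [v = v p q] leaves only traces
    of [v]. In particular [V] is finite dimensional. *)
Lemma trace_dual_bases :
  exists D : seq (V * V), forall v, v = \sum_(d <- D) t (v * d.2) *: d.1.
Proof.
have [L LP] := trace_coordinates [seq p.2 | p <- repr f].
exists [seq (p.1 * l.1, l.2 * p.2) | p <- repr f, l <- L] => v.
rewrite big_allpairs_dep /= exchange_big /=.
rewrite -[LHS]mulr1 -[in LHS](sep_one fP) mulr_sumr.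
have -> : \sum_(p <- repr f) v * (p.1 * p.2)
    = \sum_(p <- repr f) \sum_(l <- L) t (p.2 * l.2) *: (v * p.1 * l.1).
  rewrite big_seq [RHS]big_seq; apply: eq_bigr => p pf.
  rewrite {1}(LP p.2 (map_f snd pf)) mulrA mulr_sumr.
  by apply: eq_bigr => l _; rewrite -scalerAr.
rewrite exchange_big; apply: eq_bigr => l _.
have bG : bilin (fun a b => t (b * l.2) *: (a * l.1)).
  split=> [b|a] e x y.
    by rewrite mulrDl -scalerAl scalerDr !scalerA mulrC.
  by rewrite mulrDl -scalerAl tD tZ scalerDl scalerA.
rewrite (@sep_outer f fP _ (fun a b => t (b * l.2) *: (a * l.1)) bG).
by apply: eq_bigr => p _; rewrite mulrA traceC mulrA traceC mulrA.
Qed.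

Definition sep_trace : V := \sum_(p <- repr f) t p.2 *: p.1.

Let scale_trace_bilin : @bilin k V V V (fun a b => t b *: a).
Proof.
split=> [b|a] e x y; first by rewrite scalerDr !scalerA mulrC.
by rewrite tD tZ scalerDl scalerA.
Qed.

Lemma sep_trace_move v : \sum_(p <- repr f) t (p.2 * v) *: p.1 = v * sep_trace.
Proof.
rewrite -(@sep_outer f fP _ (fun a b => t b *: a)) // mulr_sumr.
by apply: eq_bigr => p _; rewrite -scalerAr.
Qed.

Lemma sep_trace_central v : v * sep_trace = sep_trace * v.
Proof.
rewrite -sep_trace_move mulr_suml.
have := sep_inner v fP scale_trace_bilin => h.
under eq_bigr do rewrite traceC; rewrite -h.
by apply: eq_bigr => p _; rewrite -scalerAl.
Qed.

(** Rewriting [1 = p q] in the dual bases [x, y] of the trace gives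
    [1 = z (y x)] with [z] the partial trace of [f], which is central. *)
Lemma sep_trace_inv : exists w, w * sep_trace = 1 /\ sep_trace * w = 1.
Proof.
have [D DP] := trace_dual_bases.
exists (\sum_(d <- D) d.2 * d.1).
suff h : (\sum_(d <- D) d.2 * d.1) * sep_trace = 1 by rewrite -sep_trace_central.
rewrite -(sep_one fP) mulr_suml.
have -> : \sum_(p <- repr f) p.1 * p.2
    = \sum_(p <- repr f) \sum_(d <- D) t (p.2 * d.2) *: (p.1 * d.1).
  apply: eq_bigr => p _; rewrite {1}(DP p.2) mulr_sumr.
  by apply: eq_bigr => d _; rewrite -scalerAr.
rewrite exchange_big; apply: eq_bigr => d _ /=.
rewrite -mulrA sep_trace_central mulrA -sep_trace_move mulr_suml.
by apply: eq_bigr => p _; rewrite -scalerAl.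
Qed.

Lemma sep_trace_dual w v : w * sep_trace = 1 ->
  \sum_(p <- repr f) t (v * w * p.2) *: p.1 = v.
Proof.
move=> wz; under eq_bigr do rewrite traceC.
by rewrite sep_trace_move -mulrA wz mulr1.
Qed.

End SeparabilityElement.

Section AntiIsomorphism.
Variables (k : fieldType) (U V : algType k) (h : U -> V).
Hypotheses (lh : linear h) (h1 : h 1 = 1) (hM : forall u v, h (u * v) = h v * h u).
Hypothesis h_onto : forall v, exists u, h u = v.

(** Reversing the product exchanges the two centrality conditions of a
    symmetric separability element. *)
Lemma anti_iso_Kanzaki : Kanzaki_separable U -> Kanzaki_separable V.
Proof.
case=> f fP; have [Pl Pr] := kpure_bilin V V.
have bG : bilin (fun a b => kpure (h a) (h b)).
  by split=> [b|a] x y z; rewrite lh ?Pl ?Pr.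
pose s := [seq (h p.1, h p.2) | p <- repr f].
have Vsum (Z : lmodType k) (G : V -> V -> Z) : bilin G ->
    ksum G (ksum (fun a b => kpure (h a) (h b)) f)
    = \sum_(p <- repr f) G (h p.1) (h p.2).
  move=> GB; transitivity (ksum G (\sum_(p <- s) kpure p.1 p.2)).
    by rewrite big_map.
  by rewrite ksum_seq // big_map.
exists (ksum (fun a b => kpure (h a) (h b)) f); split=> [v||].
- have [u <-] := h_onto v.
  rewrite !Vsum; try by split=> [b|a] x y z;
    rewrite ?mulrDr ?mulrDl -?scalerAr -?scalerAl ?Pl ?Pr.
  have := sep_inner u fP bG => e; under eq_bigr do rewrite -hM.
  by rewrite e; under eq_bigr do rewrite hM.
- rewrite Vsum; last exact: mulr_bilin.
  under eq_bigr do rewrite -hM.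
  have bH : bilin (fun a b : U => h (b * a)).
    by split=> [b|a] x y z; rewrite ?mulrDr ?mulrDl -?scalerAr -?scalerAl lh.
  by rewrite (sep_flip fP bH) -(linear_bigsum _ _ lh) (sep_one fP).
- rewrite Vsum; last by split=> [b|a] x y z; rewrite ?Pl ?Pr.
  by rewrite (sep_flip fP (G := fun a b => kpure (h b) (h a)));
     last by split=> [b|a] x y z; rewrite lh ?Pl ?Pr.
Qed.

Lemma anti_iso_nondegenerate (t : U -> k) (t' : V -> k) :
  (forall u, t' (h u) = t u) -> is_trace t' ->
  nondegenerate_trace t -> nondegenerate_trace t'.
Proof.
move=> tt' t'P [[_ tC] t0]; split=> // v; have [u <-] := h_onto v => hu.
suff -> : u = 0 by rewrite (linear_zero lh).
apply: t0 => u'; have := hu (h u').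
by rewrite -hM tt' tC.
Qed.

End AntiIsomorphism.

(** * Semisimplicity from a separability element *)

Section Semisimplicity.
Variables (k : fieldType) (H : algType k).

(** The projector is built by adding one vector of [I] for each coordinate
    functional that the current projector does not yet reproduce on [I]. *)
Lemma subspace_projector (I : set H) (c : nat -> H -> k) n :
  I 0 -> (forall x y, I x -> I y -> I (x + y)) ->
  (forall a x, I x -> I (a *: x)) -> (forall i, linear (c i : H -> k^o)) ->
  exists Pi : H -> H, [/\ linear Pi, forall x, I (Pi x) &
    forall x i, I x -> (i < n)%N -> c i (x - Pi x) = 0].
Proof.
move=> I0 ID IZ lc; elim: n => [|n [Pi [lPi IPi Pi0]]].
  by exists (fun _ => 0); split=> // a x y; rewrite scaler0 addr0.
have [hall|] := pselect (forall x, I x -> c n (x - Pi x) = 0).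
  exists Pi; split=> // x i Ix; rewrite ltnS leq_eqVlt => /orP[/eqP->|].
    exact: hall.
  exact: Pi0.
rewrite -existsNE => -[x0 hx0].
have [Ix0 cx0] : I x0 /\ c n (x0 - Pi x0) != 0.
  split; first by apply: contrapT => nI; apply: hx0.
  by apply/eqP => c0; apply: hx0.
pose y := (c n (x0 - Pi x0))^-1 *: (x0 - Pi x0).
have Iy : I y by apply/IZ/ID => //; rewrite -scaleN1r; apply: IZ.
have cy : c n y = 1 by rewrite (linear_scale _ _ (lc n)) /GRing.scale /= mulVf.
exists (fun x => Pi x + c n (x - Pi x) *: y); split.
- move=> a u v; rewrite lPi opprD addrACA -scalerBr lc /= scalerDl -scalerA.
  by rewrite scalerDr addrACA.
- by move=> x; apply: ID => //; apply: IZ.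
- move=> x i Ix; rewrite opprD addrA (linear_sub _ _ (lc i)).
  rewrite (linear_scale _ _ (lc i)) ltnS leq_eqVlt => /orP[/eqP->|ltin].
    by rewrite cy /GRing.scale /= mulr1 subrr.
  rewrite (Pi0 _ _ Ix ltin) /y (linear_scale _ _ (lc i)) (Pi0 _ _ Ix0 ltin).
  by rewrite !scaler0 subr0.
Qed.

(** Maschke's argument: averaging a linear projector onto a left ideal over a
    separability element [a (x) b] makes it a module projector. *)
Lemma separable_semisimple (s : seq (H * H)) (c : nat -> H -> k) n :
  (forall (Z : lmodType k) (G : H -> H -> Z) h, bilin G ->
     \sum_(p <- s) G (h * p.1) p.2 = \sum_(p <- s) G p.1 (p.2 * h)) ->
  \sum_(p <- s) p.1 * p.2 = 1 ->
  (forall i, linear (c i : H -> k^o)) ->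
  (forall x, (forall i, (i < n)%N -> c i x = 0) -> x = 0) ->
  semisimple H.
Proof.
move=> sC s1 lc sep_c I [I0 ID IM].
have IZ a x : I x -> I (a *: x) by move=> Ix; rewrite -[x]mul1r scalerAl; apply: IM.
have [Pi [lPi IPi Pi0]] := subspace_projector n I0 ID IZ lc.
have PiK x : I x -> Pi x = x.
  move=> Ix; apply/eqP; rewrite eq_sym -subr_eq0; apply/eqP/sep_c => i.
  exact: Pi0.
pose Q x := \sum_(p <- s) p.1 * Pi (p.2 * x).
have QE x : I (Q x).
  rewrite /Q; elim/big_rec: _ => [//|p y _ Iy]; apply: ID => //.
  exact: IM.
have QK x : I x -> Q x = x.
  move=> Ix; rewrite -[RHS]mul1r -s1 mulr_suml; apply: eq_bigr => p _.
  by rewrite PiK ?mulrA //; apply: IM.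
have QM h x : Q (h * x) = h * Q x.
  have bG : bilin (fun a b => a * Pi (b * x)).
    by split=> [b|a] e u v; rewrite !mulrDl -scalerAl ?lPi ?mulrDr -?scalerAr.
  have := sC _ (fun a b => a * Pi (b * x)) h bG => {}sC.
  rewrite /Q mulr_sumr; under [RHS]eq_bigr do rewrite mulrA.
  by rewrite sC; apply: eq_bigr => p _; rewrite mulrA.
have QD x y : Q (x + y) = Q x + Q y.
  rewrite /Q -big_split; apply: eq_bigr => p _ /=.
  by rewrite mulrDr (linear_add lPi) mulrDr.
exists (fun x => Q x = 0); [split|].
- by have := QM 0 0; rewrite !mul0r.
- by move=> x y Qx Qy; rewrite QD Qx Qy addr0.
- by move=> h x Qx; rewrite QM Qx mulr0.
split=> [x Ix|h]; first by rewrite QK.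
exists (Q h), (h - Q h); split=> //; last by rewrite addrC subrK.
by apply: (addIr (Q (Q h))); rewrite -QD subrK add0r (QK (Q h)).
Qed.

End Semisimplicity.

(** * The action of the second centralizer on the first basic construction *)

Reserved Notation "b ▷ x" (at level 40, left associativity).
Reserved Notation "x ◁ b" (at level 40, left associativity).

(** A key sealing the actions and the pairing, so that unification does not
    see the scalar multiplication at their head. *)
Fact tower_key : unit. Proof. exact: tt. Qed.

Section Tower.
Variables (k : fieldType) (N M M1 M2 : algType k).
Variables (i0 : {lrmorphism N -> M}) (i1 : {lrmorphism M -> M1}).
Variables (i2 : {lrmorphism M1 -> M2}) (E : {linear M2 -> M1}).
Variables (e1 : M1) (e2 : M2) (lam : k) (T : M1 -> k).

Local Notation V := (relative_centralizer i1).
Local Notation B := (relative_centralizer (i2 \o i1)).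
Local Notation vin := (@cincl k M M1 i1).
Local Notation bin := (@cincl k M M2 (i2 \o i1)).

Variable hat : V -> B.

Definition in_A (a : M1) := forall n, a * i1 (i0 n) = i1 (i0 n) * a.
Definition in_V (x : M1) := forall m, x * i1 m = i1 m * x.

(** The relations satisfied by two steps of the Jones tower; [T] is the trace
    of [M1] and [hat] the anti-isomorphism of [C_M1(M)] onto [C_M2(M1)].
    By [jt_shadow], left multiplication of [e1] by elements of [A] factors
    through [V]. *)
Record jones_tower : Prop := JonesTower {
  jt_lam : lam != 0;
  jt_E_bimod : forall x c y, E (i2 x * c * i2 y) = x * E c * y;
  jt_E1 : E 1 = 1;
  jt_Ee2 : E e2 = lam *: 1;
  jt_pulll : forall c, c * e2 = i2 (lam^-1 *: E (c * e2)) * e2;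
  jt_pullr : forall c, e2 * c = e2 * i2 (lam^-1 *: E (e2 * c));
  jt_e2_comm : forall m, e2 * i2 (i1 m) = i2 (i1 m) * e2;
  jt_e1_comm : in_A e1;
  jt_e121 : i2 e1 * e2 * i2 e1 = lam *: i2 e1;
  jt_e212 : e2 * i2 e1 * e2 = lam *: e2;
  jt_span1 : forall P : M1 -> Prop, P 0 ->
    (forall x y, P x -> P y -> P (x + y)) ->
    (forall m m', P (i1 m * e1 * i1 m')) -> forall x, P x;
  jt_one2 : exists s : seq (M1 * M1), \sum_(p <- s) i2 p.1 * e2 * i2 p.2 = 1;
  jt_trace : is_trace T;
  jt_trace2 : forall c d, T (E (c * d)) = T (E (d * c));
  jt_shadow : forall a, in_A a -> exists v : V, a * e1 = vin v * e1;
  jt_Tve1 : forall v : V, T (vin v * e1) = lam * T (vin v);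
  jt_hat_comm : forall v x, bin (hat v) * i2 x = i2 x * bin (hat v);
  jt_hat_e2 : forall v, bin (hat v) * e2 = i2 (vin v) * e2;
  jt_e2_hat : forall v, e2 * bin (hat v) = e2 * i2 (vin v);
  jt_nondegA : forall a, in_A a -> (forall a', in_A a' -> T (a * a') = 0) -> a = 0
}.

Hypothesis J : jones_tower.

Let lam0 := jt_lam J.
Let lamK : lam^-1 * lam = 1. Proof. by rewrite mulVf ?lam0. Qed.

Let lam2K : lam ^- 2 * lam = lam^-1.
Proof. by rewrite expr2 invfM -mulrA lamK mulr1. Qed.

Lemma T_linear : linear (T : M1 -> k^o).
Proof. by case: (jt_trace J). Qed.
Let TC x y : T (x * y) = T (y * x). Proof. by case: (jt_trace J). Qed.
Let TZ a x : T (a *: x) = a * T x := linear_scale a x T_linear.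
Let TD : {morph T : x y / x + y} := linear_add T_linear.
Let T_sum (I : Type) (s : seq I) (g : I -> M1) :
  T (\sum_(i <- s) g i) = \sum_(i <- s) T (g i) := linear_bigsum s g T_linear.

Let El x c : E (i2 x * c) = x * E c.
Proof. by have := jt_E_bimod J x c 1; rewrite rmorph1 !mulr1. Qed.
Let Er c y : E (c * i2 y) = E c * y.
Proof. by have := jt_E_bimod J 1 c y; rewrite rmorph1 !mul1r. Qed.
Let Ei x : E (i2 x) = x.
Proof. by rewrite -[i2 x]mulr1 El (jt_E1 J) mulr1. Qed.

Lemma E_e2 x y : E (i2 x * e2 * i2 y) = lam *: (x * y).
Proof. by rewrite (jt_E_bimod J) (jt_Ee2 J) -scalerAr mulr1 -scalerAl. Qed.

Lemma E_e2l x : E (i2 x * e2) = lam *: x.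
Proof. by rewrite El (jt_Ee2 J) -scalerAr mulr1. Qed.

Lemma E_e2r y : E (e2 * i2 y) = lam *: y.
Proof. by rewrite Er (jt_Ee2 J) -scalerAl mul1r. Qed.

Definition act (b : M2) (x : M1) : M1 :=
  locked_with tower_key (lam^-1 *: E (b * i2 x * e2)).
Definition ract (x : M1) (b : M2) : M1 :=
  locked_with tower_key (lam^-1 *: E (e2 * i2 x * b)).
Local Notation "b ▷ x" := (act b x).
Local Notation "x ◁ b" := (ract x b).

Lemma actE b x : b ▷ x = lam^-1 *: E (b * i2 x * e2).
Proof. exact: locked_withE. Qed.

Lemma ractE x b : x ◁ b = lam^-1 *: E (e2 * i2 x * b).
Proof. exact: locked_withE. Qed.

Lemma act_linl x : linear (fun b => b ▷ x).
Proof.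
by move=> a b c; rewrite !actE !mulrDl -!scalerAl linearP scalerDr !scalerA [a * _]mulrC.
Qed.

Lemma act_linr b : linear (act b).
Proof.
move=> a x y; rewrite !actE linearP mulrDr -scalerAr mulrDl -scalerAl linearP.
by rewrite scalerDr !scalerA [a * _]mulrC.
Qed.

Lemma ract_linl b : linear (fun x => x ◁ b).
Proof.
move=> a x y; rewrite !ractE linearP mulrDr -scalerAr mulrDl -scalerAl linearP.
by rewrite scalerDr !scalerA [a * _]mulrC.
Qed.

Lemma ract_linr x : linear (ract x).
Proof.
by move=> a b c; rewrite !ractE mulrDr -scalerAr linearP scalerDr !scalerA [a * _]mulrC.
Qed.

Lemma act_e2 b x : b * i2 x * e2 = i2 (b ▷ x) * e2.
Proof. by rewrite actE {1}(jt_pulll J). Qed.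

Lemma e2_ract b x : e2 * i2 x * b = e2 * i2 (x ◁ b).
Proof. by rewrite ractE -mulrA {1}(jt_pullr J) mulrA. Qed.

Lemma actM b c x : (b * c) ▷ x = b ▷ (c ▷ x).
Proof.
rewrite [LHS]actE [RHS]actE; congr (_ *: E _).
by rewrite -2!mulrA [c * _]mulrA act_e2 !mulrA.
Qed.

Lemma ractM x b c : x ◁ (b * c) = (x ◁ b) ◁ c.
Proof.
by rewrite [LHS]ractE [RHS]ractE mulrA e2_ract.
Qed.

Lemma act_i2 y x : i2 y ▷ x = y * x.
Proof. by rewrite !actE -rmorphM E_e2l scalerA lamK scale1r. Qed.

Lemma act1 x : 1 ▷ x = x.
Proof. by rewrite -(rmorph1 i2) act_i2 mul1r. Qed.

Lemma act_hat v x : bin (hat v) ▷ x = x * vin v.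
Proof.
rewrite !actE (jt_hat_comm J) -mulrA (jt_hat_e2 J) mulrA -rmorphM E_e2l.
by rewrite scalerA lamK scale1r.
Qed.

Lemma ract_hat v x : x ◁ bin (hat v) = vin v * x.
Proof.
rewrite !ractE -mulrA -(jt_hat_comm J) mulrA (jt_e2_hat J) -mulrA -rmorphM E_e2r.
by rewrite scalerA lamK scale1r.
Qed.

Lemma bin_comm b m : bin b * i2 (i1 m) = i2 (i1 m) * bin b.
Proof. exact: (cincl_comm b m). Qed.

Lemma act_bimod b m x m' :
  bin b ▷ (i1 m * x * i1 m') = i1 m * (bin b ▷ x) * i1 m'.
Proof.
rewrite !actE !rmorphM !mulrA bin_comm -!mulrA -(jt_e2_comm J) !mulrA.
by rewrite -2![X in E (X * _)]mulrA (jt_E_bimod J) -scalerAr -scalerAl !mulrA.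
Qed.

Lemma ract_bimod b m x m' :
  (i1 m * x * i1 m') ◁ bin b = i1 m * (x ◁ bin b) * i1 m'.
Proof.
rewrite !ractE !rmorphM !mulrA (jt_e2_comm J) -!mulrA -bin_comm !mulrA.
by rewrite -2![X in E (X * _)]mulrA (jt_E_bimod J) -scalerAr -scalerAl !mulrA.
Qed.

(** [1] is a sum of elements [x e2 y], and [c x e2 = (c ▷ x) e2]. *)
Lemma act_faithful c : (forall x, c ▷ x = 0) -> c = 0.
Proof.
move=> c0; have [s s1] := jt_one2 J.
rewrite -[c]mulr1 -s1 mulr_sumr big1 // => p _.
by rewrite !mulrA act_e2 c0 rmorph0 !mul0r.
Qed.

Lemma bin_eq b c : bin b ▷ e1 = bin c ▷ e1 -> b = c.
Proof.
move=> bc; apply: cincl_inj; apply/eqP; rewrite -subr_eq0; apply/eqP.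
apply: act_faithful => x; rewrite (linear_sub _ _ (act_linl x)).
elim/(jt_span1 J): x => [|x y IHx IHy|m m'].
- by rewrite !(linear_zero (act_linr _)) subrr.
- by rewrite !(linear_add (act_linr _)) opprD addrACA IHx IHy addr0.
- by rewrite !act_bimod bc subrr.
Qed.

Lemma act_adjoint b x y : T ((b ▷ x) * y) = T (x * (y ◁ b)).
Proof.
rewrite !actE !ractE -scalerAl -scalerAr !TZ; congr (_ * _).
by rewrite -Er -El -!mulrA (jt_trace2 J) -!mulrA.
Qed.

Lemma in_A_act b a : in_A a -> in_A (bin b ▷ a).
Proof.
move=> aA n; have := act_bimod b 1 a (i0 n); rewrite rmorph1 !mul1r => <-.
by rewrite aA; have := act_bimod b (i0 n) a 1; rewrite rmorph1 !mulr1.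
Qed.

Lemma in_A_ract b a : in_A a -> in_A (a ◁ bin b).
Proof.
move=> aA n; have := ract_bimod b 1 a (i0 n); rewrite rmorph1 !mul1r => <-.
by rewrite aA; have := ract_bimod b (i0 n) a 1; rewrite rmorph1 !mulr1.
Qed.

Lemma in_AM a a' : in_A a -> in_A a' -> in_A (a * a').
Proof. by move=> aA aA' n; rewrite -mulrA aA' mulrA aA mulrA. Qed.

Lemma in_A1 : in_A 1. Proof. by move=> n; rewrite mul1r mulr1. Qed.

Lemma in_VA x : in_V x -> in_A x. Proof. by move=> xV n; apply: xV. Qed.

Definition in_C (c : M2) :=
  forall n, c * i2 (i1 (i0 n)) = i2 (i1 (i0 n)) * c.

Lemma in_CM c d : in_C c -> in_C d -> in_C (c * d).
Proof. by move=> cC dC n; rewrite -mulrA dC mulrA cC mulrA. Qed.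

Lemma in_C_i2 a : in_A a -> in_C (i2 a).
Proof. by move=> aA n; rewrite -rmorphM aA rmorphM. Qed.

Lemma in_C_e2 : in_C e2. Proof. by move=> n; apply: (jt_e2_comm J). Qed.

Lemma in_C_bin b : in_C (bin b). Proof. by move=> n; apply: bin_comm. Qed.

Lemma in_A_E c : in_C c -> in_A (E c).
Proof. by move=> cC n; rewrite -Er cC El. Qed.

Lemma in_V_vin v : in_V (vin v). Proof. exact: cincl_comm. Qed.

Lemma in_A_vin v : in_A (vin v). Proof. exact/in_VA/in_V_vin. Qed.

Lemma in_V_act b v : exists v', vin v' = bin b ▷ vin v.
Proof.
apply: cincl_onto => m.
have := act_bimod b 1 (vin v) m; rewrite rmorph1 !mul1r => <-.
by rewrite in_V_vin; have := act_bimod b m (vin v) 1; rewrite rmorph1 !mulr1.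
Qed.

Lemma in_V_ract b v : exists v', vin v' = vin v ◁ bin b.
Proof.
apply: cincl_onto => m.
have := ract_bimod b 1 (vin v) m; rewrite rmorph1 !mul1r => <-.
by rewrite in_V_vin; have := ract_bimod b m (vin v) 1; rewrite rmorph1 !mulr1.
Qed.

Lemma in_V_E b : exists v, vin v = E (bin b).
Proof. by apply: cincl_onto => m; rewrite -Er bin_comm El. Qed.

Lemma in_B_vin v : exists b, bin b = i2 (vin v).
Proof.
by apply: cincl_onto => m /=; rewrite -!rmorphM /= cincl_comm.
Qed.

Definition v2b (v : V) : B := xget 0 [set b | bin b = i2 (vin v)].

Lemma v2bE v : bin (v2b v) = i2 (vin v).
Proof. by rewrite /v2b; case: xgetP => [b _ //|h]; have [b /h] := in_B_vin v. Qed.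

(** ** The counit functional of the first centralizer *)

Variables (f : ktensor V V) (w w' : V).
Let tV (v : V) : k := T (E (i2 (vin v))).
Hypothesis fP : symmetric_separability_element f.
Hypothesis tVP : nondegenerate_trace tV.
Hypothesis ww' : w * w' = 1.
Hypothesis w'w : w' * w = 1.
Hypothesis w'E : w' = sep_trace tV f.

Let tVE v : tV v = T (vin v). Proof. by rewrite /tV Ei. Qed.

Lemma w_central v : v * w = w * v.
Proof.
have h := sep_trace_central tVP fP v; rewrite -w'E in h.
by rewrite -[v * w]mul1r -ww' -!mulrA [w' * _]mulrA -h -mulrA w'w mulr1.
Qed.

Lemma f_dual v : \sum_(p <- repr f) T (vin (v * w * p.2)) *: p.1 = v.
Proof.
have := sep_trace_dual tVP fP v; rewrite -w'E => /(_ w ww') {2}<-.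
by apply: eq_bigr => p _; rewrite tVE.
Qed.

(** The functional [<_, 1>], that is, the counit of [A] dual to the unit
    of [B]. *)
Definition epsA (x : M1) : k := lam^-1 * T (x * e1 * vin w).

Lemma epsA_linear : linear (epsA : M1 -> k^o).
Proof.
move=> a x y; rewrite /epsA !mulrDl -!scalerAl TD TZ mulrDr.
by congr (_ + _); rewrite mulrCA.
Qed.

Lemma epsA_vin v : epsA (vin v) = T (vin (v * w)).
Proof.
rewrite /epsA TC mulrA -rmorphM (jt_Tve1 J) mulrA lamK mul1r.
by rewrite w_central.
Qed.

(** Modulo the left annihilator of [e1], an element of the first
    centralizer is an element of [V]; on [V] the functional is [T (_ * w)],
    which reproduces elements when contracted with [f]. *)
Lemma epsA_mul x y : in_A x -> in_A y ->
  epsA (x * y) = \sum_(p <- repr f) epsA (x * vin p.1) * epsA (vin p.2 * y).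
Proof.
move=> xA yA; have [v yv] := jt_shadow J yA.
have Fy z : epsA (z * y) = epsA (z * vin v) by rewrite /epsA -!mulrA [y * _]mulrA yv !mulrA.
rewrite Fy -{1}[v]f_dual raddf_sum mulr_sumr (linear_bigsum _ _ epsA_linear).
apply: eq_bigr => p _ /=; rewrite linearZ /= -scalerAr (linear_scale _ _ epsA_linear).
rewrite Fy -rmorphM epsA_vin [RHS]mulrC; congr (_ * _).
by rewrite -[LHS]tVE -[RHS]tVE (traceC tVP) mulrA.
Qed.

(** ** Dual bases for the pairing of the two centralizers *)

Variable D : seq (B * B).
Hypothesis DP : dual_bases i2 E [seq (val p.1, val p.2) | p <- D].
Hypothesis D_index : \sum_(p <- D) bin p.1 * bin p.2 = lam^-1 *: 1.

Let Dl c : \sum_(p <- D) i2 (E (c * bin p.1)) * bin p.2 = c.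
Proof. by have [] := DP c; rewrite big_map. Qed.
Let Dr c : \sum_(p <- D) bin p.1 * i2 (E (bin p.2 * c)) = c.
Proof. by have [_] := DP c; rewrite big_map. Qed.

Lemma act_mulr c x y : c ▷ (x * y) = (c * i2 x) ▷ y.
Proof. by rewrite actM act_i2. Qed.

Lemma act_sum (I : Type) (s : seq I) (g : I -> M2) x :
  (\sum_(i <- s) g i) ▷ x = \sum_(i <- s) (g i ▷ x).
Proof. exact: (linear_bigsum _ _ (act_linl x)). Qed.

(** In the dual bases, [a e2] is a sum of terms [b a'] with [b] in [B] and [a']
    in [A]; on [e1] the factor [a'] can be replaced by an element of [V], which
    lies in [B].  Multiplying [a e2 e1] by [e2] gives back a multiple of
    [a e2]. *)
Lemma act_e1_onto a : in_A a -> exists b, bin b ▷ e1 = a.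
Proof.
move=> aA; have [g gP] := choice (fun b => jt_shadow J (in_A_act b aA)).
exists (\sum_(p <- D) p.1 * v2b (g p.2)).
rewrite raddf_sum act_sum /=.
have -> : \sum_(p <- D) (bin (p.1 * v2b (g p.2)) ▷ e1)
    = (\sum_(p <- D) bin p.1 * i2 (bin p.2 ▷ a)) ▷ e1.
  rewrite act_sum; apply: eq_bigr => p _.
  by rewrite rmorphM /= v2bE actM act_i2 -gP act_mulr.
have -> : \sum_(p <- D) bin p.1 * i2 (bin p.2 ▷ a) = lam^-1 *: (i2 a * e2).
  rewrite -[in RHS](Dr (i2 a * e2)) scaler_sumr; apply: eq_bigr => p _.
  by rewrite actE linearZ /= -scalerAr mulrA.
rewrite (linear_scale _ _ (act_linl e1)) actM act_i2 actE (jt_e212 J) linearZ /=.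
by rewrite (jt_Ee2 J) !scalerA lamK mul1r -scalerAr mulr1 scalerA lamK scale1r.
Qed.

Definition dpair (a : M1) (b : M2) : k := locked_with tower_key
  (lam ^- 2 * T (E (i2 a * e2 * i2 e1 * i2 (vin w) * b))).

Lemma dpair_def a b :
  dpair a b = lam ^- 2 * T (E (i2 a * e2 * i2 e1 * i2 (vin w) * b)).
Proof. exact: locked_withE. Qed.

Lemma dpairE a b : dpair a b = epsA (b ▷ a).
Proof.
rewrite dpair_def (jt_trace2 J) !mulrA act_e2 -mulrA -rmorphM E_e2 TZ mulrA /epsA mulrA.
congr (_ * _).
by rewrite expr2 invfM -mulrA lamK mulr1.
Qed.

Let e121_mulr c : c * i2 e1 * e2 * i2 e1 = lam *: (c * i2 e1).
Proof. by rewrite -mulrA -mulrA [i2 e1 * _]mulrA (jt_e121 J) -scalerAr. Qed.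

(** This makes the pairing with [beta ▷ e1] the trace form of [B], twisted by
    [w]: [<beta ▷ e1, b> = epsA(b beta ▷ e1)]. *)
Lemma epsA_act_e1 b : epsA (bin b ▷ e1) = T (E (bin b) * vin w).
Proof.
have [v vE] := in_V_E b.
rewrite /epsA actE -!scalerAl TZ -!Er e121_mulr.
rewrite -scalerAl linearZ /= TZ [_ * (lam * _)]mulrA lamK mul1r.
rewrite !Er TC -vE mulrA -rmorphM (jt_Tve1 J) mulrA lamK mul1r -rmorphM.
by rewrite w_central.
Qed.

Lemma v2b_linear : linear v2b.
Proof. by move=> a u v; apply: cincl_inj; rewrite linearP /= !v2bE !linearP. Qed.

Lemma v2bM u v : v2b (u * v) = v2b u * v2b v.
Proof. by apply: cincl_inj; rewrite rmorphM /= !v2bE !rmorphM. Qed.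

(** The dual bases of the trace of [B] composed of those of [V] and of
    [E] are the [w f2 v_j] and the [u_j f1], with [u_j], [v_j] those of [E];
    the factor [w^-1] undoes the twist of the trace form. *)
Definition dual_a (p : B * B) (q : V * V) : B := v2b (w * q.2) * p.2 * v2b w'.
Definition dual_b (p : B * B) (q : V * V) : B := p.1 * v2b q.1.

Lemma dual_aA p q : in_A (bin (dual_a p q) ▷ e1).
Proof. exact/in_A_act/(jt_e1_comm J). Qed.

Lemma dpair_basis b : b = \sum_(p <- D) \sum_(q <- repr f)
  dpair (bin (dual_a p q) ▷ e1) (bin b) *: dual_b p q.
Proof.
have prv p q v : vin v = E (bin (p.2 * b)) ->
    dpair (bin (dual_a p q) ▷ e1) (bin b) = T (vin (v * w * q.2)).
  move=> vE; rewrite dpairE -actM -rmorphM epsA_act_e1 /dual_a !rmorphM /= !v2bE.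
  rewrite !mulrA Er -mulrA -rmorphM w'w rmorph1 mulr1.
  by rewrite (jt_trace2 J) mulrA Er -rmorphM -vE -rmorphM mulrA.
apply: cincl_inj; rewrite raddf_sum /= -{1}[bin b]Dr; apply: eq_bigr => p _.
have [v vE] := in_V_E (p.2 * b).
have -> : \sum_(q <- repr f) dpair (bin (dual_a p q) ▷ e1) (bin b) *: dual_b p q
    = p.1 * v2b v.
  rewrite -[v]f_dual (linear_bigsum _ _ v2b_linear) mulr_sumr.
  apply: eq_bigr => q _; rewrite (prv p q v) // (linear_scale _ _ v2b_linear).
  by rewrite -scalerAr.
by rewrite [in RHS]rmorphM /= v2bE vE rmorphM.
Qed.

Lemma dpair_linr a : linear ((fun b : B => dpair a (bin b)) : B -> k^o).
Proof.
move=> x b c; rewrite !dpairE linearP /= act_linl.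
by rewrite epsA_linear.
Qed.

Lemma dpair_linl b : linear ((fun a => dpair a b) : M1 -> k^o).
Proof. by move=> x a c; rewrite !dpairE act_linr epsA_linear. Qed.

Lemma dpair_eq b c :
  (forall a, in_A a -> dpair a (bin b) = dpair a (bin c)) -> b = c.
Proof.
move=> bc; rewrite [b]dpair_basis [c]dpair_basis.
by apply: eq_bigr => p _; apply: eq_bigr => q _; rewrite bc //; apply: dual_aA.
Qed.

(** ** The comultiplication *)

(** [s] represents the value at [b] of the comultiplication dual to the product
    of [A]. *)
Definition comul (b : B) (s : seq (B * B)) := forall a a', in_A a -> in_A a' ->
  \sum_(p <- s) dpair a (bin p.1) * dpair a' (bin p.2) = dpair (a * a') (bin b).

Lemma bilin_basis (Z : lmodType k) (G : B -> B -> Z) b c : bilin G ->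
  G b c = \sum_(p <- D) \sum_(q <- repr f) \sum_(p' <- D) \sum_(q' <- repr f)
    (dpair (bin (dual_a p q) ▷ e1) (bin b) * dpair (bin (dual_a p' q') ▷ e1) (bin c))
      *: G (dual_b p q) (dual_b p' q').
Proof.
move=> [Gl Gr].
rewrite {1}[b]dpair_basis (linear_bigsum _ _ (Gl c)); apply: eq_bigr => p _.
rewrite (linear_bigsum _ _ (Gl c)); apply: eq_bigr => q _.
rewrite (linear_scale _ _ (Gl c)) {1}[c]dpair_basis.
rewrite (linear_bigsum _ _ (Gr _)) scaler_sumr; apply: eq_bigr => p' _.
rewrite (linear_bigsum _ _ (Gr _)) scaler_sumr; apply: eq_bigr => q' _.
by rewrite (linear_scale _ _ (Gr _)) scalerA.
Qed.

(** Nondegeneracy of the pairing in two variables: [bilin_basis] expands every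
    bilinear function in products of pairings. *)
Lemma sum_bilin_eq (s s' : seq (B * B)) :
  (forall a a', in_A a -> in_A a' ->
     \sum_(p <- s) dpair a (bin p.1) * dpair a' (bin p.2)
       = \sum_(p <- s') dpair a (bin p.1) * dpair a' (bin p.2)) ->
  forall (Z : lmodType k) (G : B -> B -> Z), bilin G ->
  \sum_(p <- s) G p.1 p.2 = \sum_(p <- s') G p.1 p.2.
Proof.
move=> ss' Z G bG.
under eq_bigr do rewrite (bilin_basis _ _ bG).
under [RHS]eq_bigr do rewrite (bilin_basis _ _ bG).
rewrite exchange_big [RHS]exchange_big; apply: eq_bigr => p _.
rewrite exchange_big [RHS]exchange_big; apply: eq_bigr => q _.
rewrite exchange_big [RHS]exchange_big; apply: eq_bigr => p' _.
rewrite exchange_big [RHS]exchange_big; apply: eq_bigr => q' _.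
by rewrite -!scaler_suml ss' //; apply: dual_aA.
Qed.

(** [M1] is generated by [e1] as an [M]-bimodule and [B] commutes with [M], so
    it suffices to expand [b e1]; its coefficients on the dual bases [D] lie in
    the first centralizer, which is [B ▷ e1]. *)
Lemma act_mul_exists b : exists s : seq (B * B), forall x y,
  bin b ▷ (x * y) = \sum_(p <- s) (bin p.1 ▷ x) * (bin p.2 ▷ y).
Proof.
have coefA c : in_A (E (bin b * i2 e1 * bin c)).
  apply/in_A_E/in_CM; last exact: in_C_bin.
  by apply: in_CM; [apply: in_C_bin | apply/in_C_i2/(jt_e1_comm J)].
have [g gP] := choice (fun c => act_e1_onto (coefA c)).
exists [seq (g p.1, p.2) | p <- D] => x y.
rewrite act_mulr; suff -> : bin b * i2 x = \sum_(p <- D) i2 (bin (g p.1) ▷ x) * bin p.2.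
  by rewrite act_sum big_map; apply: eq_bigr => p _; rewrite actM act_i2.
elim/(jt_span1 J): x => [|x z IHx IHz|m m'].
- rewrite rmorph0 mulr0 big1 // => p _.
  by rewrite (linear_zero (act_linr _)) rmorph0 mul0r.
- rewrite rmorphD mulrDr IHx IHz -big_split; apply: eq_bigr => p _.
  by rewrite (linear_add (act_linr _)) rmorphD mulrDl.
- rewrite !rmorphM !mulrA bin_comm -2!mulrA [bin b * _]mulrA -[bin b * i2 e1]Dl.
  rewrite mulr_suml mulr_sumr; apply: eq_bigr => p _.
  by rewrite -mulrA bin_comm act_bimod gP !rmorphM !mulrA.
Qed.

(** Inserting the separability element of [V] between the two legs of such an
    expansion leaves the product unchanged, as [f1 f2 = 1], and by [epsA_mul]
    it makes the legs pair with two factors as [b] pairs with their product. *)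
Lemma comul_exists b : exists2 s, comul b s & forall x y,
  bin b ▷ (x * y) = \sum_(p <- s) (bin p.1 ▷ x) * (bin p.2 ▷ y).
Proof.
have [s sP] := act_mul_exists b.
exists [seq (hat q.1 * p.1, v2b q.2 * p.2) | p <- s, q <- repr f] => [a a' aA a'A|x y];
  rewrite big_allpairs_dep /=.
- rewrite dpairE sP (linear_bigsum _ _ epsA_linear); apply: eq_bigr => p _.
  rewrite epsA_mul; try exact: in_A_act.
  by apply: eq_bigr => q _; rewrite !dpairE !rmorphM /= !actM act_hat v2bE act_i2.
- rewrite sP; apply: eq_bigr => p _.
  rewrite -[X in X * _]mulr1 -(rmorph1 vin) -(sep_one fP) raddf_sum mulr_sumr mulr_suml.
  apply: eq_bigr => q _.
  by rewrite /= !rmorphM /= !actM act_hat v2bE act_i2 !mulrA.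
Qed.

Lemma comul_act b s x y : comul b s ->
  bin b ▷ (x * y) = \sum_(p <- s) (bin p.1 ▷ x) * (bin p.2 ▷ y).
Proof.
move=> sP; have [s' s'P ->] := comul_exists b.
apply: (@sum_bilin_eq s' s _ _ (fun b c => (bin b ▷ x) * (bin c ▷ y))) => [a a' aA a'A|].
  by rewrite sP ?s'P.
split=> [c|c] e u v; rewrite linearP act_linl.
  by rewrite mulrDl -scalerAl.
by rewrite mulrDr -scalerAr.
Qed.

(** ** Moving the second centralizer to the left *)

(** Both sides lie in [A]; by adjointness their traces against [a] are
    [lam <a,b1> <y,b2>] and [lam <a y,b>]. *)
Lemma comul_ract_e1 b s y : comul b s -> in_A y ->
  \sum_(p <- s) dpair y (bin p.2) *: ((e1 * vin w) ◁ bin p.1)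
    = lam^-1 *: E (i2 y * e2 * i2 e1 * i2 (vin w) * bin b).
Proof.
move=> sP yA; apply/eqP; rewrite -subr_eq0; apply/eqP/(jt_nondegA J).
  have e1A := jt_e1_comm J; have wA := in_A_vin w.
  have dA c : in_A ((e1 * vin w) ◁ bin c) by apply/in_A_ract/in_AM.
  have EA : in_A (E (i2 y * e2 * i2 e1 * i2 (vin w) * bin b)).
    apply: in_A_E; do !apply: in_CM; [exact: in_C_i2 | exact: in_C_e2 | | |];
      by [exact: in_C_i2 | exact: in_C_bin].
  move=> n; rewrite mulrBl mulrBr mulr_suml mulr_sumr; congr (_ - _).
    by apply: eq_bigr => p _; rewrite -scalerAl dA scalerAr.
  by rewrite -scalerAl -scalerAr EA.
move=> a aA; rewrite mulrBl (linear_sub _ _ T_linear) mulr_suml T_sum.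
have -> : \sum_(p <- s) T (dpair y (bin p.2) *: ((e1 * vin w) ◁ bin p.1) * a)
    = lam * dpair (a * y) (bin b).
  rewrite -sP // mulr_sumr; apply: eq_bigr => p _.
  rewrite -scalerAl TZ TC -act_adjoint (dpairE a) /epsA.
  move: (dpair y _) => u; rewrite !mulrA.
  by rewrite mulfV ?lam0 // mul1r mulrC.
rewrite -scalerAl TZ TC -El dpair_def rmorphM !mulrA.
by rewrite expr2 invfM mulrA mulfV ?lam0 // mul1r subrr.
Qed.

(** [comul_ract_e1] gives the pairings of the second leg; summing over the
    dual bases of the pairing recovers that leg, and the factor [w^-1] placed
    between [f1] and [w f2] collapses the separability element. *)
Lemma comul_ract b s x : comul b s ->
  i2 x * bin b
    = \sum_(p <- s) i2 (vin w) * bin p.2 * i2 (vin w') * i2 (x ◁ bin p.1).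
Proof.
move=> sP.
have e1E : \sum_(p <- s) bin p.2 * i2 (vin w') * i2 ((e1 * vin w) ◁ bin p.1)
    = i2 (vin w') * i2 e1 * i2 (vin w) * bin b.
  transitivity (\sum_(p <- D) \sum_(q <- repr f) bin (dual_b p q) * i2 (vin w') *
      i2 (\sum_(r <- s) dpair (bin (dual_a p q) ▷ e1) (bin r.2)
                          *: ((e1 * vin w) ◁ bin r.1))).
    under eq_bigr => r _ do rewrite {1}[r.2]dpair_basis raddf_sum !mulr_suml /=.
    rewrite exchange_big; apply: eq_bigr => p _.
    under eq_bigr => r _ do rewrite raddf_sum !mulr_suml /=.
    rewrite exchange_big; apply: eq_bigr => q _.
    rewrite raddf_sum mulr_sumr; apply: eq_bigr => r _.
    by rewrite /= !linearZ -scalerAr -!scalerAl.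
  rewrite -[RHS]Dr; apply: eq_bigr => p _.
  set c := i2 (vin w') * _ * _ * _.
  transitivity (\sum_(q <- repr f) bin p.1 * i2 (vin (q.1 * q.2) * E (bin p.2 * c))).
    apply: eq_bigr => q _; rewrite (comul_ract_e1 sP (dual_aA p q)).
    rewrite -act_e2 e121_mulr -!scalerAl [E (_ *: _)]linearZ /= scalerA lamK scale1r.
    have -> : bin (dual_a p q) * i2 e1 * i2 (vin w) * bin b
        = i2 (vin (w * q.2)) * (bin p.2 * c).
      by rewrite /dual_a !(rmorphM bin) /= !v2bE /c !mulrA.
    rewrite El /dual_b (rmorphM bin) /= v2bE -2!mulrA -!(rmorphM i2); congr (_ * i2 _).
    by rewrite !mulrA -!(rmorphM vin) -[q.1 * w' * w]mulrA w'w mulr1.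
  rewrite -mulr_sumr -raddf_sum -mulr_suml -(raddf_sum vin) (sep_one fP).
  by rewrite /= rmorph1 mul1r.
suff xwE : i2 (x * vin w') * i2 (vin w) * bin b
    = \sum_(p <- s) i2 (vin w) * bin p.2 * i2 (vin w')
                     * i2 ((x * vin w' * vin w) ◁ bin p.1).
  by move: xwE; rewrite -rmorphM -mulrA -rmorphM w'w rmorph1 mulr1.
move: (x * vin w') => {x}; elim/(jt_span1 J) => [|x y IHx IHy|m m'].
- rewrite rmorph0 !mul0r big1 // => p _.
  by rewrite (linear_zero (ract_linl _)) rmorph0 mulr0.
- rewrite rmorphD !mulrDl IHx IHy -big_split; apply: eq_bigr => p _ /=.
  by rewrite -mulrDr -rmorphD -(linear_add (ract_linl _)) .
- have wM : i1 m * e1 * i1 m' * vin w = i1 m * (e1 * vin w) * i1 m'.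
    by rewrite -!mulrA in_V_vin.
  rewrite -rmorphM wM !rmorphM /= -!mulrA -bin_comm !mulrA.
  have -> : i2 (i1 m) * i2 e1 * i2 (vin w) * bin b
      = i2 (i1 m) * (i2 (vin w) * (i2 (vin w') * i2 e1 * i2 (vin w) * bin b)).
    by rewrite !mulrA -[_ * i2 (vin w')]mulrA -!rmorphM ww' rmorph1 mulr1.
  rewrite -e1E !mulr_sumr mulr_suml; apply: eq_bigr => p _.
  rewrite -[i1 m * e1 * _]mulrA ract_bimod !rmorphM /= !mulrA; congr (_ * _ * _).
  have mw u : i2 (i1 m) * i2 (vin u) = i2 (vin u) * i2 (i1 m).
    by rewrite -!rmorphM in_V_vin.
  by rewrite -[RHS]mulrA -mw mulrA -[_ * bin _ * i2 (i1 m)]mulrA bin_comm mulrA -mw.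
Qed.

(** ** The antipode *)

Lemma comul_ractM b s z x : comul b s ->
  (z * x) ◁ bin b
    = \sum_(p <- s) (((z * vin w) ◁ bin p.2) * vin w') * (x ◁ bin p.1).
Proof.
move=> sP; rewrite ractE rmorphM mulrA -[e2 * _ * _ * _]mulrA (comul_ract x sP).
rewrite mulr_sumr raddf_sum scaler_sumr; apply: eq_bigr => p _.
rewrite !mulrA -[e2 * i2 z * _]mulrA -rmorphM e2_ract -!mulrA -!(rmorphM i2) /= E_e2r.
by rewrite scalerA lamK scale1r mulrA.
Qed.

(** The relation between [b] and [S(b)], in terms of the actions; see
    [antipode_ofE] for the two pairings. *)
Definition antipode_of (b c : B) :=
  forall x, bin c ▷ x = ((x * vin w) ◁ bin b) * vin w'.

(** Both sides are [M]-bilinear in [x], so the value at [e1], which lies in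
    [A = B ▷ e1], determines [S(b)]. *)
Lemma antipode_exists b : exists c, antipode_of b c.
Proof.
have [|c cE] := @act_e1_onto (((e1 * vin w) ◁ bin b) * vin w').
  apply: in_AM (in_A_vin _); apply: in_A_ract.
  exact: in_AM (jt_e1_comm J) (in_A_vin _).
exists c; elim/(jt_span1 J) => [|x y IHx IHy|m m'].
- by rewrite mul0r (linear_zero (act_linr _)) (linear_zero (ract_linl _)) mul0r.
- by rewrite (linear_add (act_linr _)) mulrDl (linear_add (ract_linl _)) mulrDl IHx IHy.
- have wM : i1 m * e1 * i1 m' * vin w = i1 m * (e1 * vin w) * i1 m'.
    by rewrite -!mulrA in_V_vin.
  by rewrite wM ract_bimod act_bimod cE -!mulrA in_V_vin.
Qed.

Lemma in_A_eq a a' : in_A a -> in_A a' ->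
  (forall y, in_A y -> T (a * y) = T (a' * y)) -> a = a'.
Proof.
move=> aA aA' aa'; apply/eqP; rewrite -subr_eq0; apply/eqP/(jt_nondegA J) => [n|y yA].
  by rewrite mulrBl mulrBr aA aA'.
by rewrite mulrBl (linear_sub _ _ T_linear) aa' ?subrr.
Qed.

Definition dpair' (a : M1) (b : M2) : k :=
  lam ^- 2 * T (E (b * i2 e1 * e2 * i2 (vin w) * i2 a)).

Lemma dpair'E a b : dpair' a b = lam^-1 * T ((b ▷ e1) * (vin w * a)).
Proof.
by rewrite /dpair' act_e2 -mulrA -rmorphM E_e2 TZ [lam ^- 2 * _]mulrA lam2K.
Qed.

Lemma dpair_ract a b : dpair a b = lam^-1 * T (a * ((e1 * vin w) ◁ b)).
Proof.
rewrite dpair_def ractE -scalerAr TZ mulrA -El rmorphM !mulrA.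
by rewrite expr2 invfM.
Qed.

Lemma antipode_ofE b c :
  antipode_of b c <-> forall a, in_A a -> dpair a (bin b) = dpair' a (bin c).
Proof.
have fwd d : antipode_of b d -> forall a, in_A a -> dpair a (bin b) = dpair' a (bin d).
  move=> dP a _; rewrite dpair_ract dpair'E dP -mulrA [vin w' * _]mulrA -rmorphM w'w.
  by rewrite rmorph1 mul1r [in RHS]TC.
split=> [/fwd//|h]; have [d dP] := antipode_exists b.
suff -> : c = d by [].
have e1A := jt_e1_comm J; apply: bin_eq.
have dcA u : in_A (bin u ▷ e1 * vin w).
  by apply: in_AM (in_A_vin _); apply: in_A_act.
suff : bin c ▷ e1 * vin w = bin d ▷ e1 * vin w.
  move=> /(congr1 (fun x => x * vin w')).
  by rewrite -!mulrA -!rmorphM ww' rmorph1 !mulr1.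
apply: in_A_eq => // y yA; apply: (mulfI (invr_neq0 lam0)).
by rewrite -![_ * vin w * y]mulrA -!dpair'E -h // (fwd _ dP).
Qed.

Lemma hat_linear : linear hat.
Proof.
by move=> a u v; apply: bin_eq; rewrite linearP act_linl !act_hat linearP mulrDr -scalerAr.
Qed.

Section Antipode.
Variable S : B -> B.
Hypothesis SP : forall b, antipode_of b (S b).

Lemma antipode_lin : linear S.
Proof.
move=> a u v; apply: bin_eq.
by rewrite linearP act_linl !SP linearP ract_linr mulrDl -scalerAl.
Qed.

Lemma antipode_hat v b : S (hat v * b) = S b * v2b v.
Proof.
apply: bin_eq; rewrite SP !rmorphM /= ractM ract_hat actM v2bE act_i2 SP.
by rewrite mulrA.
Qed.

(** By adjointness [h1 S(h2)] is tested on [(S(h2) ▷ x) (y ◁ h1)], which is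
    [(x y) ◁ h]. *)
Lemma comul_antipode_r h s v : comul h s -> vin v = bin h ▷ 1 ->
  \sum_(p <- s) p.1 * S p.2 = v2b v.
Proof.
move=> sP vE; apply: bin_eq; have e1A := jt_e1_comm J.
apply: in_A_eq; try exact: in_A_act.
move=> y _; rewrite v2bE act_i2 vE -mulrA [RHS]act_adjoint mul1r (comul_ractM _ _ sP).
rewrite raddf_sum act_sum mulr_suml !T_sum; apply: eq_bigr => p _.
by rewrite /= rmorphM /= actM act_adjoint SP.
Qed.

(** Likewise [S(h1) h2] is tested on [(h1 ▷ y) (h2 ▷ x)], which is
    [h ▷ (y x)]; the two factors [w] come from the definition of [S]. *)
Lemma comul_antipode_l h s v : comul h s -> vin v = vin w ◁ bin h ->
  \sum_(p <- s) S p.1 * p.2 = hat (v * w').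
Proof.
move=> sP vE; apply: bin_eq; have e1A := jt_e1_comm J.
apply: in_A_eq; try exact: in_A_act.
move=> y _; have -> : T (bin (hat (v * w')) ▷ e1 * y)
    = T (bin h ▷ (vin w' * y * e1) * vin w).
  rewrite act_hat rmorphM /= act_adjoint -vE -!mulrA TC -!mulrA.
  by rewrite [LHS]TC -!mulrA.
rewrite (comul_act _ _ sP) raddf_sum act_sum !mulr_suml !T_sum.
apply: eq_bigr => p _.
by rewrite /= rmorphM /= actM SP -mulrA TC -act_adjoint mulrA.
Qed.

(** The case [y = 1] of [b ▷ (x y) = (b1 ▷ x) (b2 ▷ y)], where [hat] acts by
    right multiplication. *)
Lemma comul_act1 h s (ev : B -> V) : comul h s ->
  (forall b, vin (ev b) = bin b ▷ 1) -> \sum_(p <- s) hat (ev p.2) * p.1 = h.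
Proof.
move=> sP evE; apply: bin_eq; rewrite -[in RHS](mulr1 e1) (comul_act _ _ sP).
rewrite raddf_sum act_sum; apply: eq_bigr => p _.
by rewrite /= rmorphM /= actM act_hat evE.
Qed.

End Antipode.

(** ** Products, units and the coalgebra structure *)

Lemma dpair_mul a h g : dpair a (bin (h * g)) = dpair (bin g ▷ a) (bin h).
Proof. by rewrite !dpairE rmorphM /= actM. Qed.

(** [<a, h g> = <g ▷ a, h>], and [g] acts on a product through its
    comultiplication. *)
Lemma comul_mul h g s t : comul h s -> comul g t ->
  comul (h * g) [seq (p.1 * q.1, p.2 * q.2) | p <- s, q <- t].
Proof.
move=> sP tP a a' aA aA'; rewrite big_allpairs_dep dpair_mul (comul_act _ _ tP).
rewrite exchange_big (linear_bigsum _ _ (dpair_linl _)); apply: eq_bigr => q _.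
rewrite -sP; try exact: in_A_act.
by apply: eq_bigr => p _; rewrite !dpair_mul.
Qed.

Lemma comul_hat v :
  comul (hat v) [seq (hat q.1, v2b q.2 * hat v) | q <- repr f].
Proof.
move=> a a' aA aA'; rewrite big_map dpairE act_hat -mulrA epsA_mul //; last first.
  by apply: in_AM (in_A_vin _).
apply: eq_bigr => q _.
by rewrite !dpairE rmorphM /= actM !act_hat v2bE act_i2.
Qed.

Lemma comul_one : comul 1 [seq (hat q.1, v2b q.2) | q <- repr f].
Proof.
move=> a a' aA aA'; rewrite big_map dpairE rmorph1 act1 epsA_mul //.
by apply: eq_bigr => q _; rewrite !dpairE act_hat v2bE act_i2.
Qed.

Lemma comul_pr_r g s v : comul g s ->
  \sum_(p <- s) dpair (vin v) (bin p.2) *: p.1 = g * hat v.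
Proof.
move=> sP; apply: dpair_eq => a aA; rewrite (linear_bigsum _ _ (dpair_linr a)) dpair_mul.
rewrite act_hat -sP //; last exact: in_A_vin.
by apply: eq_bigr => p _; rewrite (linear_scale _ _ (dpair_linr a)) mulrC.
Qed.

Lemma comul_pr_l g s v : comul g s ->
  \sum_(p <- s) dpair (vin v) (bin p.1) *: p.2 = g * v2b v.
Proof.
move=> sP; apply: dpair_eq => a aA; rewrite (linear_bigsum _ _ (dpair_linr a)) dpair_mul.
rewrite v2bE act_i2 -sP //; last exact: in_A_vin.
by apply: eq_bigr => p _; rewrite (linear_scale _ _ (dpair_linr a)).
Qed.

Lemma v2b1 : v2b 1 = 1.
Proof. by apply: cincl_inj; rewrite v2bE !rmorph1. Qed.

(** The third variable is expanded in the dual bases of the pairing, and its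
    coordinate absorbed in the first one, which reduces to two variables. *)
Lemma sum_trilin_eq (s s' : seq (B * B * B)) :
  (forall a a' a'', in_A a -> in_A a' -> in_A a'' ->
     \sum_(p <- s) dpair a (bin p.1.1) * dpair a' (bin p.1.2) * dpair a'' (bin p.2)
     = \sum_(p <- s') dpair a (bin p.1.1) * dpair a' (bin p.1.2) * dpair a'' (bin p.2)) ->
  forall (Z : lmodType k) (G : B -> B -> B -> Z),
  (forall d, bilin (fun b c => G b c d)) -> (forall b c, linear (G b c)) ->
  \sum_(p <- s) G p.1.1 p.1.2 p.2 = \sum_(p <- s') G p.1.1 p.1.2 p.2.
Proof.
move=> ss' Z G bG lG.
have expand t : \sum_(p <- t) G p.1.1 p.1.2 p.2
  = \sum_(p <- D) \sum_(q <- repr f) \sum_(r <- [seq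
      (dpair (bin (dual_a p q) ▷ e1) (bin r.2) *: r.1.1, r.1.2) | r <- t])
      G r.1 r.2 (dual_b p q).
  under eq_bigr => r _.
    rewrite {1}[r.2]dpair_basis (linear_bigsum _ _ (lG _ _)); over.
  rewrite exchange_big; apply: eq_bigr => p _.
  under eq_bigr => r _ do rewrite (linear_bigsum _ _ (lG _ _)).
  rewrite exchange_big; apply: eq_bigr => q _; rewrite big_map.
  apply: eq_bigr => r _; rewrite (linear_scale _ _ (lG _ _)).
  by have [Gl _] := bG (dual_b p q); rewrite (linear_scale _ _ (Gl _)).
rewrite !expand; apply: eq_bigr => p _; apply: eq_bigr => q _.
apply: (sum_bilin_eq _ (bG (dual_b p q))) => a a' aA aA'; rewrite !big_map.
transitivity (\sum_(r <- s) dpair a (bin r.1.1) * dpair a' (bin r.1.2)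
                * dpair (bin (dual_a p q) ▷ e1) (bin r.2)).
  apply: eq_bigr => r _; rewrite (linear_scale _ _ (dpair_linr a)) /GRing.scale /=.
  by rewrite -[LHS]mulrA [LHS]mulrC.
rewrite ss' //; last exact: dual_aA.
apply: eq_bigr => r _; rewrite (linear_scale _ _ (dpair_linr a)) /GRing.scale /=.
by rewrite -[RHS]mulrA [RHS]mulrC.
Qed.

(** ** The weak Hopf algebra *)

Section WeakHopfStructure.
Variables (Delta : B -> ktensor B B) (eps : B -> k) (S : B -> B).
Hypothesis DeltaP : forall b, comul b (repr (Delta b)).
Hypothesis epsE : forall b, eps b = dpair 1 (bin b).
Hypothesis SP : forall b, antipode_of b (S b).

Lemma dpair2_bilin a a' :
  @bilin k B B k^o (fun b c => dpair a (bin b) * dpair a' (bin c)).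
Proof.
split=> [c|b] x u v; rewrite (dpair_linr _ _) /GRing.scale /=.
  by rewrite mulrDl mulrA.
by rewrite mulrDr mulrCA.
Qed.

Lemma ktensor_ext (t t' : ktensor B B) :
  (forall a a', in_A a -> in_A a' ->
     ksum (fun b c => dpair a (bin b) * dpair a' (bin c)) t
     = ksum (fun b c => dpair a (bin b) * dpair a' (bin c)) t') -> t = t'.
Proof.
move=> tt'; rewrite [t]ktensorE [t']ktensorE.
exact: (sum_bilin_eq tt' (kpure_bilin B B)).
Qed.

Lemma Delta_sum b s (Z : lmodType k) (G : B -> B -> Z) : comul b s -> bilin G ->
  ksum G (Delta b) = \sum_(p <- s) G p.1 p.2.
Proof.
move=> sP bG; apply: sum_bilin_eq (bG) => a a' aA aA'.
by rewrite sP // DeltaP.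
Qed.

Lemma Delta_seq b s : comul b s -> Delta b = \sum_(p <- s) kpure p.1 p.2.
Proof.
move=> sP; rewrite [LHS]ktensorE.
exact: (Delta_sum sP (kpure_bilin B B)).
Qed.

Lemma Delta_lin : linear Delta.
Proof.
move=> x b c; apply: ktensor_ext => a a' aA aA'.
rewrite (ksum_linear (dpair2_bilin a a')) ![ksum _ (Delta _)]DeltaP //.
by rewrite linearP /= (dpair_linr _ _).
Qed.

Lemma eps_lin : linear (eps : B -> k^o).
Proof. by move=> a b c; rewrite !epsE (dpair_linr _ _). Qed.

(** Both sides pair with [a], [a'], [a''] as [<a a' a'', h>]. *)
Lemma coassoc h : Delta_id Delta (Delta h) = id_Delta Delta (Delta h).
Proof.
have [Pl Pr] := kpure_bilin (ktensor B B) B; have [pl pr] := kpure_bilin B B.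
have [Ql Qr] := kpure_bilin B (ktensor B B).
pose G b c d : ktensor (ktensor B B) B := kpure (kpure b c) d.
have bG d : bilin (fun b c => G b c d).
  by split=> ? ? ? ?; rewrite /G ?pl ?pr Pl.
have -> : Delta_id Delta (Delta h) = \sum_(r <- [seq (q.1, q.2, p.2) |
    p <- repr (Delta h), q <- repr (Delta p.1)]) G r.1.1 r.1.2 r.2.
  rewrite big_allpairs_dep; apply: eq_bigr => p _.
  by rewrite {1}[Delta p.1]ktensorE (linear_bigsum _ _ (Pl _)).
have -> : id_Delta Delta (Delta h) = \sum_(r <- [seq (p.1, q.1, q.2) |
    p <- repr (Delta h), q <- repr (Delta p.2)]) G r.1.1 r.1.2 r.2.
  by rewrite big_allpairs_dep id_DeltaE.
apply: sum_trilin_eq => // [a a' a'' aA a'A a''A|b c x u v]; last by rewrite /G Pr.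
rewrite !big_allpairs_dep /=.
transitivity (dpair (a * a' * a'') (bin h)).
  rewrite -(DeltaP h) //; last exact: in_AM.
  by apply: eq_bigr => p _; rewrite -mulr_suml DeltaP.
rewrite -mulrA -(DeltaP h) //; last exact: in_AM.
by apply: eq_bigr => p _; rewrite -DeltaP // mulr_sumr; apply: eq_bigr => q _; rewrite mulrA.
Qed.

Lemma B_coalgebra : coalgebra Delta eps.
Proof.
split; [exact: Delta_lin | exact: eps_lin | exact: coassoc | |] => h.
- apply: dpair_eq => a aA; rewrite /eps_id /ksum /tsum /fsum.
  rewrite (linear_bigsum _ _ (dpair_linr a)) -[in RHS](mul1r a) -DeltaP //; last exact: in_A1.
  by apply: eq_bigr => p _; rewrite (linear_scale _ _ (dpair_linr a)) epsE.
- apply: dpair_eq => a aA; rewrite /id_eps /ksum /tsum /fsum.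
  rewrite (linear_bigsum _ _ (dpair_linr a)) -[in RHS](mulr1 a) -DeltaP //; last exact: in_A1.
  by apply: eq_bigr => p _; rewrite (linear_scale _ _ (dpair_linr a)) epsE mulrC.
Qed.

Lemma Delta_multiplicative h g : Delta (h * g) = mul2 (Delta h) (Delta g).
Proof.
rewrite (Delta_seq (comul_mul (DeltaP h) (DeltaP g))).
by rewrite big_allpairs_dep.
Qed.

Lemma act_unit b : exists v, vin v = bin b ▷ 1.
Proof. by have [v vE] := in_V_act b 1; exists v; rewrite vE rmorph1. Qed.

Lemma eps_lin_mull h : linear ((fun b => eps (h * b)) : B -> k^o).
Proof. by move=> a b c; rewrite mulrDr -scalerAr eps_lin. Qed.

Lemma eps_pr g v h : vin v = bin h ▷ 1 -> eps (g * h) = dpair (vin v) (bin g).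
Proof. by move=> ->; rewrite epsE dpair_mul. Qed.

Lemma counit_mul12 h g g' : eps (h * g * g')
  = ksum (fun g1 g2 => eps (h * g1) * eps (g2 * g')) (Delta g).
Proof.
have [v vE] := act_unit g'.
transitivity (eps (h * (g * hat v))).
  by rewrite -!mulrA !epsE !dpair_mul !rmorphM /= !actM act_hat mul1r vE.
rewrite -(comul_pr_r v (DeltaP g)) (linear_bigsum _ _ (eps_lin_mull h)).
apply: eq_bigr => p _; rewrite (linear_scale _ _ (eps_lin_mull h)) mulrC.
by rewrite (eps_pr p.2 vE).
Qed.

Lemma counit_mul21 h g g' : eps (h * g * g')
  = ksum (fun g1 g2 => eps (h * g2) * eps (g1 * g')) (Delta g).
Proof.
have [v vE] := act_unit g'.
transitivity (eps (h * (g * v2b v))).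
  by rewrite -!mulrA !epsE !dpair_mul !rmorphM /= !actM v2bE act_i2 mulr1 vE.
rewrite -(comul_pr_l v (DeltaP g)) (linear_bigsum _ _ (eps_lin_mull h)).
apply: eq_bigr => p _; rewrite (linear_scale _ _ (eps_lin_mull h)) mulrC.
by rewrite (eps_pr p.1 vE).
Qed.

Lemma Delta1E : Delta 1 = \sum_(q <- repr f) kpure (hat q.1) (v2b q.2).
Proof. by rewrite (Delta_seq comul_one) big_map. Qed.

Lemma Delta_hatE v :
  Delta (hat v) = \sum_(q <- repr f) kpure (hat q.1) (v2b q.2 * hat v).
Proof. by rewrite (Delta_seq (comul_hat v)) big_map. Qed.

Lemma v2b_hat_comm u v : v2b u * hat v = hat v * v2b u.
Proof. by apply: cincl_inj; rewrite !rmorphM /= v2bE (jt_hat_comm J). Qed.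

Lemma Delta_id_Delta1 : Delta_id Delta (Delta 1) =
  \sum_(q <- repr f) \sum_(r <- repr f)
    kpure (kpure (hat r.1) (v2b r.2 * hat q.1)) (v2b q.2).
Proof.
have [Pl Pr] := kpure_bilin (ktensor B B) B.
have bG : bilin (fun b c : B => kpure (Delta b) c).
  by split=> ? ? ? ?; rewrite ?Delta_lin ?Pl ?Pr.
rewrite /Delta_id (Delta_sum comul_one bG) big_map; apply: eq_bigr => q _ /=.
by rewrite Delta_hatE (linear_bigsum _ _ (Pl _)).
Qed.

Lemma Delta1_left : kpure (Delta 1) 1
  = \sum_(q <- repr f) kpure (kpure (hat q.1) (v2b q.2)) 1 :> ktensor (ktensor B B) B.
Proof.
have [Pl _] := kpure_bilin (ktensor B B) B.
by rewrite Delta1E (linear_bigsum _ _ (Pl _)).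
Qed.

Lemma Delta1_right : kassoc (kpure 1 (Delta 1))
  = \sum_(q <- repr f) kpure (kpure 1 (hat q.1)) (v2b q.2) :> ktensor (ktensor B B) B.
Proof. by rewrite kassoc_pure (Delta_sum comul_one (kpure3_bilin 1)) big_map. Qed.

Let mul3_bilin : bilin (@mul3 k B).
Proof. exact: kmul_bilin (mul2_bilin B) (mulr_bilin B). Qed.

Let mul3_sums (I I' : Type) (s : seq I) (s' : seq I') g g' :
  mul3 (\sum_(i <- s) g i) (\sum_(j <- s') g' j)
    = \sum_(i <- s) \sum_(j <- s') mul3 (g i) (g' j) :> ktensor (ktensor B B) B.
Proof.
have [Ml Mr] := mul3_bilin.
rewrite (linear_bigsum _ _ (Ml _)); apply: eq_bigr => i _.
by rewrite (linear_bigsum _ _ (Mr _)).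
Qed.

Let mul3_pure (a b c a' b' c' : B) :
  mul3 (kpure (kpure a b) c) (kpure (kpure a' b') c')
    = kpure (kpure (a * a') (b * b')) (c * c').
Proof.
by rewrite /mul3 (kmul_pure _ _ _ _ (mul2_bilin B) (mulr_bilin B)) mul2_pure.
Qed.

Lemma comul_unit12 : Delta_id Delta (Delta 1)
  = mul3 (kpure (Delta 1) 1) (kassoc (kpure 1 (Delta 1))).
Proof.
rewrite Delta_id_Delta1 Delta1_left Delta1_right mul3_sums exchange_big.
by apply: eq_bigr => q _; apply: eq_bigr => r _; rewrite mul3_pure mulr1 mul1r.
Qed.

Lemma comul_unit21 : Delta_id Delta (Delta 1)
  = mul3 (kassoc (kpure 1 (Delta 1))) (kpure (Delta 1) 1).
Proof.
rewrite Delta_id_Delta1 Delta1_left Delta1_right mul3_sums.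
apply: eq_bigr => q _; apply: eq_bigr => r _.
by rewrite mul3_pure mulr1 mul1r v2b_hat_comm.
Qed.

Let T_scale_bilin u : @bilin k V V V (fun a b => T (vin (u * b)) *: a).
Proof.
split=> [b|a] x y z; first by rewrite scalerDr !scalerA [_ * x]mulrC.
by rewrite mulrDr -scalerAr linearP TD TZ scalerDl scalerA.
Qed.

(** [Delta 1 = hat f1 (x) f2] and [eps(hat f1 h) = T(v f1 w)], so this is the
    reproducing property of [f] and [w]. *)
Lemma counital_target h v : vin v = bin h ▷ 1 ->
  eps_id eps (mul2 (Delta 1) (kpure h 1)) = v2b v.
Proof.
move=> vE; have [Pl Pr] := mul2_bilin B.
have bG : bilin (fun b c : B => eps b *: c).
  split=> [c|b] x y z; last by rewrite scalerDr !scalerA mulrC.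
  by rewrite eps_lin scalerDl -scalerA.
rewrite /eps_id Delta1E (linear_bigsum _ _ (Pl _)) (linear_bigsum _ _ (ksum_linear bG)).
rewrite -[in RHS](f_dual v) (sep_flip fP (T_scale_bilin (v * w))).
rewrite (linear_bigsum _ _ v2b_linear); apply: eq_bigr => q _.
rewrite mul2_pure (ksum_pure _ _ bG) mulr1 (linear_scale _ _ v2b_linear).
by rewrite epsE dpair_mul dpairE act_hat -vE -rmorphM epsA_vin -!mulrA w_central.
Qed.

(** [eps(h f2)] is the trace of [(h ▷ f2) w], and [h] moves over to [w] by
    adjointness. *)
Lemma counital_source h v : vin v = vin w ◁ bin h ->
  id_eps eps (mul2 (kpure 1 h) (Delta 1)) = hat (v * w').
Proof.
move=> vE; have [Pl Pr] := mul2_bilin B.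
have bG : bilin (fun b c : B => eps c *: b).
  split=> [c|b] x y z; first by rewrite scalerDr !scalerA mulrC.
  by rewrite eps_lin scalerDl -scalerA.
rewrite /id_eps Delta1E (linear_bigsum _ _ (Pr _)) (linear_bigsum _ _ (ksum_linear bG)).
rewrite -[in RHS](f_dual (v * w')) (linear_bigsum _ _ hat_linear).
apply: eq_bigr => q _.
rewrite mul2_pure (ksum_pure _ _ bG) mul1r (linear_scale _ _ hat_linear).
congr (_ *: _); rewrite -[v * w' * w]mulrA w'w mulr1.
have [u uE] := in_V_act h q.2.
rewrite epsE dpair_mul v2bE act_i2 mulr1 dpairE -uE epsA_vin rmorphM /= uE.
by rewrite act_adjoint -vE -rmorphM -tVE (traceC tVP) tVE.
Qed.

(** [h2 S(h3)] is the element [h2 ▷ 1] of [V], and [S(h1) v = S(hat v h1)];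
    the sum of the [hat (h2 ▷ 1) h1] is [h]. *)
Lemma antipode_middle h :
  ksum (fun t h3 => ksum (fun h1 h2 => S h1 * h2 * S h3) t)
       (Delta_id Delta (Delta h)) = S h.
Proof.
rewrite coassoc.
have lS := antipode_lin SP.
have bG c : bilin (fun a b : B => S a * b * S c).
  split=> [b|a] x y z; first by rewrite lS !mulrDl -!scalerAl.
  by rewrite mulrDr mulrDl -scalerAr -scalerAl.
have bH : bilin (fun (t : ktensor B B) c => ksum (fun a b => S a * b * S c) t).
  split=> [c|t] x y z; first by rewrite (ksum_linear (bG c)).
  rewrite /ksum /tsum /fsum scaler_sumr -big_split; apply: eq_bigr => q _ /=.
  by rewrite lS mulrDr -scalerAr.
have [ev evE] := choice act_unit.
rewrite -[in RHS](comul_act1 (DeltaP h) evE) (linear_bigsum _ _ lS).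
rewrite id_DeltaE (linear_bigsum _ _ (ksum_linear bH)).
apply: eq_bigr => p _ /=; rewrite (antipode_hat SP).
rewrite -(comul_antipode_r SP (DeltaP p.2) (evE p.2)) mulr_sumr.
rewrite (linear_bigsum _ _ (ksum_linear bH)); apply: eq_bigr => q _.
by rewrite (ksum_pure _ _ bH) (ksum_pure _ _ (bG _)) mulrA.
Qed.

Theorem tower_weak_hopf : weak_hopf_algebra Delta eps S.
Proof.
split; [exact: B_coalgebra | exact: Delta_multiplicative | exact: counit_mul12
  | exact: counit_mul21 | exact: comul_unit12 | exact: comul_unit21
  | exact: antipode_lin | | | exact: antipode_middle] => h.
- have [v vE] := act_unit h.
  by rewrite (counital_target vE); apply: (comul_antipode_r SP).
- have [v vE] := in_V_ract h w.
  by rewrite (counital_source vE); apply: (comul_antipode_l SP).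
Qed.

End WeakHopfStructure.

(** ** Semisimplicity *)

(** The separability element [lam u_j f1 (x) f2 v_j] is obtained by composing
    the one of [V] with the dual bases of [E], whose product is the index. *)
Theorem tower_semisimple : semisimple B.
Proof.
pose L := [seq bin (dual_a p q) ▷ e1 | p <- D, q <- repr f].
pose s := [seq (lam *: (p.1 * v2b q.1), v2b q.2 * p.2) | p <- D, q <- repr f].
have [ev evE] := choice in_V_E.
have Bl h (p : B * B) : h * p.1 = \sum_(r <- D) r.1 * v2b (ev (r.2 * h * p.1)).
  apply: cincl_inj; rewrite raddf_sum /= -[LHS]Dr; apply: eq_bigr => r _.
  by rewrite [RHS]rmorphM /= v2bE evE !rmorphM /= !mulrA.
have Br h (r : B * B) : r.2 * h = \sum_(p <- D) v2b (ev (r.2 * h * p.1)) * p.2.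
  apply: cincl_inj; rewrite raddf_sum /= -[LHS]Dl; apply: eq_bigr => p _.
  by rewrite [RHS]rmorphM /= v2bE evE !rmorphM.
apply: (@separable_semisimple k B s (fun i b => dpair (nth 0 L i) (bin b)) (size L)).
- move=> Z G h [Gl Gr]; rewrite /s !big_allpairs_dep /=.
  have bG (r p : B * B) : bilin (fun u v => G (lam *: (r.1 * v2b u)) (v2b v * p.2)).
    split=> [v|u] x y z; last by rewrite v2b_linear mulrDl -scalerAl Gr.
    by rewrite v2b_linear mulrDr -scalerAr scalerDr scalerA mulrC -scalerA Gl.
  transitivity (\sum_(p <- D) \sum_(r <- D) \sum_(q <- repr f)
      G (lam *: (r.1 * v2b (ev (r.2 * h * p.1) * q.1))) (v2b q.2 * p.2)).
    apply: eq_bigr => p _; rewrite exchange_big; apply: eq_bigr => q _.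
    rewrite -(linear_bigsum _ _ (Gl _)); congr (G _ _).
    rewrite -scalerAr mulrA Bl mulr_suml scaler_sumr; apply: eq_bigr => r _.
    by rewrite v2bM mulrA.
  rewrite exchange_big; apply: eq_bigr => r _.
  under eq_bigr => p _ do rewrite (sep_outer fP (bG r p)).
  rewrite exchange_big; apply: eq_bigr => q _.
  rewrite -(linear_bigsum _ _ (Gr _)) -mulrA [in RHS]Br mulr_sumr; congr (G _ _).
  by apply: eq_bigr => p _; rewrite v2bM mulrA.
- apply: cincl_inj; rewrite /s big_allpairs_dep raddf_sum /=.
  transitivity (\sum_(p <- D) lam *: (bin p.1 * bin p.2)).
    apply: eq_bigr => p _.
    transitivity (bin (\sum_(q <- repr f) lam *: (p.1 * v2b (q.1 * q.2) * p.2))).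
      congr (bin _); apply: eq_bigr => q _.
      by rewrite -scalerAl v2bM !mulrA.
    rewrite -scaler_sumr -mulr_suml -mulr_sumr.
    rewrite -(linear_bigsum _ _ v2b_linear) (sep_one fP) v2b1 mulr1.
    by rewrite linearZ /= rmorphM.
  by rewrite -scaler_sumr D_index scalerA mulfV ?lam0 // scale1r rmorph1.
- by move=> i; apply: dpair_linr.
- move=> b b0; rewrite [b]dpair_basis big_seq big1 // => p pD.
  rewrite big_seq big1 // => q qf.
  have aL : bin (dual_a p q) ▷ e1 \in L.
    by apply/allpairsP; exists (p, q).
  have := b0 _; rewrite -index_mem in aL => /(_ _ aL).
  by rewrite nth_index -?index_mem // => ->; rewrite scale0r.
Qed.

End Tower.

(** * The basic construction *)

(** The Casimir element of [E] does not depend on the dual bases. *)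
Lemma dual_bases_index (k : fieldType) (N M : algType k) (i : N -> M)
    (E : M -> N) (s s' : seq (M * M)) :
  dual_bases i E s -> dual_bases i E s' ->
  \sum_(p <- s) p.1 * p.2 = \sum_(p <- s') p.1 * p.2.
Proof.
move=> sP sP'.
under eq_bigr => p _ do rewrite -{1}(sP' p.1).2 mulr_suml.
rewrite exchange_big; apply: eq_bigr => q _.
rewrite -[in RHS](sP q.2).1 mulr_sumr; apply: eq_bigr => p _.
by rewrite mulrA.
Qed.

(** The relations of the basic construction [M1] of [M/N], isolated from its
    realisation as a tensor product. *)
Record basic_construction (k : fieldType) (N M M1 : algType k)
    (i : {lrmorphism N -> M}) (E : {linear M -> N}) (xs : seq (M * M))
    (j : {lrmorphism M -> M1}) (E1 : {linear M1 -> M}) (e : M1) (lam : k) :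
    Prop := BasicConstruction {
  bc_lam : lam != 0;
  bc_dual : dual_bases i E xs;
  bc_E_bimod : forall x m y, E (i x * m * i y) = x * E m * y;
  bc_sandwich : forall m, e * j m * e = j (i (E m)) * e;
  bc_comm : forall n, e * j (i n) = j (i n) * e;
  bc_ind : forall P : M1 -> Prop, P 0 -> (forall x y, P x -> P y -> P (x + y)) ->
    (forall m m', P (j m * e * j m')) -> forall x, P x;
  bc_one : \sum_(p <- xs) j p.1 * e * j p.2 = 1;
  bc_E1_bimod : forall x c y, E1 (j x * c * j y) = x * E1 c * y;
  bc_E1e : E1 e = lam *: 1
}.

Lemma basic_pureE (k : fieldType) (F : frobenius_ext k) (lam : k)
    (lam0 : lam != 0) (x y : fext F) :
  bpure x y = fincl (basic_ext F lam0) x * be F * fincl (basic_ext F lam0) y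
    :> fext (basic_ext F lam0).
Proof.
rewrite -[RHS]/(bincl x * be F * bincl y).
by rewrite binclMl bmulincl mulr1 mul1r.
Qed.

Lemma basic_ext_construction (k : fieldType) (F : frobenius_ext k) (lam : k)
    (lam0 : lam != 0) :
  basic_construction (fincl F) (fE F) (fdual F)
    (fincl (basic_ext F lam0)) (fE (basic_ext F lam0)) (be F) lam.
Proof.
have pureE := @basic_pureE k F lam lam0; set G := basic_ext F lam0 in pureE *.
set j := fincl G in pureE *.
split=> //; first exact: fdualP.
- exact: fE_bimod.
- move=> m; rewrite -[be F * j m]/(be F * bincl m) bmulincl mul1r.
  rewrite -[LHS]/(bpure 1 m * bpure 1 1) bpure_mul mul1r mulr1.
  by rewrite pureE rmorph1 mulr1.
- move=> n; have := pureE 1 (fincl F n); rewrite rmorph1 mul1r => <-.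
  have := pureE (fincl F n) 1; rewrite rmorph1 mulr1 => <-.
  by have := bpureM 1 n 1; rewrite mul1r mulr1 => ->.
- by move=> P P0 PD Pp; apply: sum_bpure_ind => // m m'; rewrite pureE.
- by rewrite -[RHS]/(bone F) /bone; apply: eq_bigr => p _; rewrite pureE.
- exact: (fE_bimod (f := G)).
- by have := @bE_pure k F lam 1 1; rewrite mulr1.
Qed.

Section BasicFacts.
Variables (k : fieldType) (N M M1 : algType k).
Variables (i : {lrmorphism N -> M}) (E : {linear M -> N}) (xs : seq (M * M)).
Variables (j : {lrmorphism M -> M1}) (E1 : {linear M1 -> M}) (e : M1) (lam : k).
Hypothesis bc : basic_construction i E xs j E1 e lam.

Local Notation U := (relative_centralizer i).
Local Notation V := (relative_centralizer j).
Local Notation uin := (@cincl k N M i).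
Local Notation vin := (@cincl k M M1 j).

Let lamK : lam^-1 * lam = 1. Proof. by rewrite mulVf // (bc_lam bc). Qed.

Lemma bc_dl m : \sum_(p <- xs) i (E (m * p.1)) * p.2 = m.
Proof. by have [] := bc_dual bc m. Qed.

Lemma bc_dr m : \sum_(p <- xs) p.1 * i (E (p.2 * m)) = m.
Proof. by have [] := bc_dual bc m. Qed.

Lemma bc_Er m n : E (m * i n) = E m * n.
Proof. by have := bc_E_bimod bc 1 m n; rewrite rmorph1 !mul1r. Qed.

Lemma bc_E1l x c : E1 (j x * c) = x * E1 c.
Proof. by have := bc_E1_bimod bc x c 1; rewrite rmorph1 !mulr1. Qed.

Lemma bc_E1r c y : E1 (c * j y) = E1 c * y.
Proof. by have := bc_E1_bimod bc 1 c y; rewrite rmorph1 !mul1r. Qed.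

Lemma bc_E1_e (x y : M) : E1 (j x * e * j y) = lam *: (x * y).
Proof. by rewrite (bc_E1_bimod bc) (bc_E1e bc) -scalerAr mulr1 -scalerAl. Qed.

Lemma bc_pulll (c : M1) : c * e = j (lam^-1 *: E1 (c * e)) * e.
Proof.
elim/(bc_ind bc): c => [|x y IHx IHy|m m'].
- by rewrite mul0r !raddf0 mul0r.
- by rewrite mulrDl raddfD scalerDr raddfD mulrDl -IHx -IHy.
- rewrite -!mulrA [e * _]mulrA (bc_sandwich bc) !mulrA -rmorphM bc_E1l (bc_E1e bc).
  by rewrite -scalerAr mulr1 scalerA lamK scale1r.
Qed.

Lemma bc_pullr (c : M1) : e * c = e * j (lam^-1 *: E1 (e * c)).
Proof.
elim/(bc_ind bc): c => [|x y IHx IHy|m m'].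
- by rewrite mulr0 !raddf0 mulr0.
- by rewrite mulrDr raddfD scalerDr raddfD mulrDr -IHx -IHy.
- rewrite !mulrA (bc_sandwich bc) -(bc_comm bc) -!mulrA -rmorphM bc_E1r (bc_E1e bc).
  by rewrite -scalerAl mul1r scalerA lamK scale1r.
Qed.

(** ** The anti-isomorphism of consecutive centralizers *)

(** The map [phi]; on [C_M(N)] it is an anti-isomorphism onto [C_M1(M)]. *)
Definition cphi (u : M) : M1 := \sum_(p <- xs) j (p.1 * u) * e * j p.2.

Lemma cphi_linear : linear cphi.
Proof.
move=> a u v; rewrite /cphi scaler_sumr -big_split; apply: eq_bigr => p _ /=.
by rewrite mulrDr -scalerAr linearP !mulrDl -!scalerAl.
Qed.

Lemma cphi1 : cphi 1 = 1.
Proof. by rewrite -(bc_one bc); apply: eq_bigr => p _; rewrite mulr1. Qed.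

(** The Casimir property of dual bases, which survives the insertion of an
    element commuting with [N]. *)
Lemma cphi_comm (u : U) m : cphi (uin u) * j m = j m * cphi (uin u).
Proof.
rewrite /cphi mulr_suml mulr_sumr.
transitivity (\sum_(q <- xs) \sum_(p <- xs)
   j (q.1 * uin u) * e * j (i (E (q.2 * m * p.1)) * p.2)).
  apply: eq_bigr => q _; rewrite -mulr_sumr -raddf_sum /= bc_dl.
  by rewrite -mulrA -rmorphM.
rewrite exchange_big; apply: eq_bigr => p _; rewrite /= !mulrA -rmorphM.
rewrite mulrA -{1}[m * p.1]bc_dr mulr_suml raddf_sum !mulr_suml.
apply: eq_bigr => q _ /=.
rewrite -[X in _ = j X * _ * _]mulrA -cincl_comm mulrA [j (_ * i _)]rmorphM.
by rewrite -[_ * j (i _) * e]mulrA -(bc_comm bc) [j (i _ * p.2)]rmorphM !mulrA.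
Qed.

Lemma cphi_e (u : U) : cphi (uin u) * e = j (uin u) * e.
Proof.
have -> : j (uin u) * e = \sum_(p <- xs) j (p.1 * i (E p.2) * uin u) * e.
  rewrite -mulr_suml -raddf_sum -mulr_suml.
  by under eq_bigr do rewrite -[X in E X]mulr1; rewrite bc_dr mul1r.
rewrite /cphi mulr_suml; apply: eq_bigr => p _.
by rewrite -2!mulrA [e * _]mulrA (bc_sandwich bc) mulrA -rmorphM -!mulrA cincl_comm.
Qed.

(** Since [v e] is a multiple [u e] by an element of [M], the relation
    [v = v x_i e y_i = x_i v e y_i] gives [v = phi u]. *)
Lemma cphi_onto (v : V) :
  exists2 u : U, vin v = cphi (uin u) & vin v * e = j (uin u) * e.
Proof.
have [n|u uE] := @cincl_onto _ _ _ i (lam^-1 *: E1 (vin v * e)).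
  rewrite -scalerAl -scalerAr -bc_E1r -bc_E1l -mulrA (bc_comm bc) !mulrA.
  by rewrite cincl_comm.
have ve : vin v * e = j (uin u) * e by rewrite uE -bc_pulll.
exists u => //; rewrite -[LHS]mulr1 -(bc_one bc) mulr_sumr; apply: eq_bigr => p _.
by rewrite !mulrA cincl_comm -[_ * vin v * e]mulrA ve mulrA -rmorphM.
Qed.

Lemma cphi_mul (u u' : U) : cphi (uin u) * cphi (uin u') = cphi (uin (u' * u)).
Proof.
rewrite (rmorphM uin) {2}/cphi mulr_sumr; apply: eq_bigr => p _.
by rewrite !mulrA cphi_comm -[_ * cphi _ * e]mulrA cphi_e mulrA -rmorphM.

Qed.

Lemma bc_shadow (a : M1) : (forall n, a * j (i n) = j (i n) * a) ->
  exists v : V, a * e = vin v * e.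
Proof.
move=> aA; have [n|u uE] := @cincl_onto _ _ _ i (lam^-1 *: E1 (a * e)).
  by rewrite -scalerAl -scalerAr -bc_E1r -bc_E1l -mulrA (bc_comm bc) !mulrA aA.
have [v vE] := cincl_onto (cphi_comm u).
by exists v; rewrite vE cphi_e uE -bc_pulll.
Qed.

Section Symmetric.
Hypothesis Esym : forall (u : U) x, E (uin u * x) = E (x * uin u).

Lemma e_cphi (u : U) : e * cphi (uin u) = e * j (uin u).
Proof.
rewrite /cphi mulr_sumr -[in RHS](bc_dl (uin u)) raddf_sum mulr_sumr.
apply: eq_bigr => p _ /=.
by rewrite !mulrA (bc_sandwich bc) -(bc_comm bc) -mulrA -rmorphM Esym.
Qed.

(** The symmetry [E(u x) = E(x u)] passes to the next step because [phi u] acts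
    on [e] as [u] from both sides. *)
Lemma E1_sym (v : V) x : E1 (vin v * x) = E1 (x * vin v).
Proof.
have [u vE ve] := cphi_onto v.
have ev : e * vin v = e * j (uin u) by rewrite vE e_cphi.
elim/(bc_ind bc): x => [|x y IHx IHy|m m'].
- by rewrite mul0r mulr0.
- by rewrite mulrDl mulrDr !raddfD /= IHx IHy.
- rewrite !mulrA cincl_comm -[j m * vin v * e]mulrA ve.
  rewrite -[RHS]/(E1 (j m * e * j m' * vin v)) -[j m * e * j m' * vin v]mulrA.
  rewrite -(cincl_comm v) !mulrA -[j m * e * vin v]mulrA ev !mulrA -rmorphM bc_E1_e.
  by rewrite -[j m * e * j _ * _]mulrA -rmorphM bc_E1_e mulrA.
Qed.

End Symmetric.

(** ** Index and traces *)

Section Index.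
Hypothesis index : \sum_(p <- xs) p.1 * p.2 = lam^-1 *: 1.

Lemma bc_E1_1 : E1 1 = 1.
Proof.
rewrite -(bc_one bc) raddf_sum /=; under eq_bigr do rewrite bc_E1_e.
by rewrite -scaler_sumr index scalerA mulfV ?(bc_lam bc) // scale1r.
Qed.

Hypothesis E1N : E 1 = 1.

Definition next_dual := [seq (lam^-1 *: (j p.1 * e), e * j p.2) | p <- xs].

Lemma next_index : \sum_(p <- next_dual) p.1 * p.2 = lam^-1 *: 1.
Proof.
rewrite big_map -(bc_one bc) scaler_sumr; apply: eq_bigr => p _ /=.
have ee : e * e = e.
  by have := bc_sandwich bc 1; rewrite rmorph1 mulr1 E1N !rmorph1 mul1r.
by rewrite -scalerAl mulrA -[_ * e * e]mulrA ee.
Qed.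

End Index.

Lemma bc_trace (T : N -> k) :
  is_trace T -> is_trace (fun m => T (E m)) -> is_trace (fun x => T (E (E1 x))).
Proof.
move=> [Tl TC] [T0l T0C]; have lT : linear (T : N -> k^o) by [].
pose T1 x := T (E (E1 x)).
have lT1 : linear (T1 : M1 -> k^o) by move=> a x y; rewrite /T1 !linearP Tl.
split=> // x y; rewrite -/(T1 (x * y)) -/(T1 (y * x)).
have TE m m' n n' : T1 (j m * e * j m' * (j n * e * j n')) = lam * T (E (m' * n) * E (n' * m)).
  have -> : j m * e * j m' * (j n * e * j n') = j (m * i (E (m' * n))) * e * j n'.
    rewrite !mulrA -[_ * j m' * j n]mulrA -rmorphM.
    by rewrite -[_ * j _ * e]mulrA -[_ * (j _ * e)]mulrA [e * _]mulrA (bc_sandwich bc)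
               mulrA -rmorphM.
  rewrite /T1 bc_E1_e linearZ /= (linear_scale _ _ lT); congr (_ * _).
  by rewrite [LHS]T0C mulrA bc_Er TC.
elim/(bc_ind bc): x => [|x x' IHx IHx'|m m'].
- by rewrite mul0r mulr0.
- by rewrite mulrDl mulrDr !(linear_add lT1) IHx IHx'.
elim/(bc_ind bc): y => [|y y' IHy IHy'|n n'].
- by rewrite mul0r mulr0.
- by rewrite mulrDl mulrDr !(linear_add lT1) IHy IHy'.
by rewrite !TE TC.
Qed.

End BasicFacts.

Lemma fdual_basic_ext (k : fieldType) (F : frobenius_ext k) (lam : k)
    (lam0 : lam != 0) :
  fdual (basic_ext F lam0)
    = next_dual (fdual F) (fincl (basic_ext F lam0)) (be F) lam.
Proof.
apply: eq_map => p; rewrite !(@basic_pureE k F lam lam0) !rmorph1 mulr1.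
by congr (_, _); rewrite mul1r.
Qed.

(** The unit of [M2], expanded in the dual bases derived from those of [M/N]
    and multiplied by [e1] on the left, collapses to [lam^-1 e1 e2 e1]. *)
Lemma e1_e2_e1 (k : fieldType) (N M M1 M2 : algType k) (i : {lrmorphism N -> M})
    (E : {linear M -> N}) (xs : seq (M * M)) (j : {lrmorphism M -> M1})
    (E1 : {linear M1 -> M}) (e1 : M1) (j2 : {lrmorphism M1 -> M2})
    (E2 : {linear M2 -> M1}) (e2 : M2) (lam : k) :
  basic_construction i E xs j E1 e1 lam ->
  basic_construction j E1 (next_dual xs j e1 lam) j2 E2 e2 lam ->
  j2 e1 * e2 * j2 e1 = lam *: j2 e1.
Proof.
move=> bc bc2; rewrite -[in RHS](mulr1 (j2 e1)) -(bc_one bc2) big_map mulr_sumr.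
have key p : j2 e1 * (j2 (lam^-1 *: (j p.1 * e1)) * e2 * j2 (e1 * j p.2))
    = lam^-1 *: (j2 e1 * e2 * j2 (e1 * j (i (E p.1) * p.2))).
  rewrite [j2 (_ *: _)]linearZ -!scalerAl -scalerAr; congr (_ *: _).
  have -> : j2 e1 * (j2 (j p.1 * e1) * e2 * j2 (e1 * j p.2))
      = j2 (e1 * j p.1 * e1) * e2 * j2 (e1 * j p.2) by rewrite !rmorphM !mulrA.
  rewrite (bc_sandwich bc) -(bc_comm bc) [j2 (e1 * _)]rmorphM.
  rewrite -[_ * e2]mulrA -(bc_comm bc2) -!mulrA -rmorphM [j _ * (e1 * _)]mulrA -(bc_comm bc).
  by rewrite -mulrA -rmorphM.
under [in RHS]eq_bigr do rewrite key.
rewrite -scaler_sumr scalerA mulfV ?(bc_lam bc) // scale1r -mulr_sumr.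
rewrite -raddf_sum /= -mulr_sumr -raddf_sum /=.
under eq_bigr do rewrite -[X in E X]mul1r.
by rewrite (bc_dl bc) rmorph1 mulr1.
Qed.

(** * Two steps of the Jones tower *)

Section TowerOfBasicConstructions.
Variables (k : fieldType) (N M M1 M2 : algType k).
Variables (i0 : {lrmorphism N -> M}) (E0 : {linear M -> N}) (xs : seq (M * M)).
Variables (i1 : {lrmorphism M -> M1}) (E1 : {linear M1 -> M}) (e1 : M1).
Variables (i2 : {lrmorphism M1 -> M2}) (E2 : {linear M2 -> M1}) (e2 : M2).
Variables (lam : k) (T : N -> k).
Hypothesis bc1 : basic_construction i0 E0 xs i1 E1 e1 lam.
Hypothesis bc2 :
  basic_construction i1 E1 (next_dual xs i1 e1 lam) i2 E2 e2 lam.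

Local Notation U := (relative_centralizer i0).
Local Notation V := (relative_centralizer i1).
Local Notation A := (relative_centralizer (i1 \o i0)).
Local Notation B := (relative_centralizer (i2 \o i1)).
Let T0 m := T (E0 m).
Let T1 x := T0 (E1 x).

Hypothesis E0_1 : E0 1 = 1.
Hypothesis E0_sym : forall (u : U) x, E0 (cincl u * x) = E0 (x * cincl u).
Hypothesis index : \sum_(p <- xs) p.1 * p.2 = lam^-1 *: 1.
Hypothesis T_trace : is_trace T.
Hypothesis T0_trace : is_trace T0.
Hypothesis symmetric :
  \sum_(p <- xs) p.2 * p.1 = lam^-1 *: 1 \/
  forall u : U, T0 (cincl u) = T1 (cphi xs i1 e1 (cincl u)).
Hypothesis U_Kanzaki : Kanzaki_separable U.
Hypothesis U_nondeg : nondegenerate_trace (fun u : U => T0 (cincl u)).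

Let T0_linear : linear (T0 : M -> k^o). Proof. by case: T0_trace. Qed.

Let T0Z a x : T0 (a *: x) = a * T0 x := linear_scale a x T0_linear.

(** Either form of the symmetric product condition yields the compatibility of
    the traces with [phi]. *)
Lemma T1_cphi (u : U) : T1 (cphi xs i1 e1 (cincl u)) = T0 (cincl u).
Proof.
case: symmetric => [ind|-> //].
rewrite /T1 /cphi raddf_sum /=.
transitivity (T0 (lam *: ((\sum_(p <- xs) p.2 * p.1) * cincl u))); last first.
  by rewrite ind -scalerAl mul1r scalerA mulfV ?(bc_lam bc1) // scale1r.
rewrite mulr_suml scaler_sumr !(linear_bigsum _ _ T0_linear).
apply: eq_bigr => p _; rewrite (bc_E1_e bc1) !T0Z.
by congr (_ * _); rewrite -[in RHS]mulrA -[RHS]T0_trace.2.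
Qed.

Let next := next_dual xs i1 e1 lam.

Let T1_trace : is_trace T1 := bc_trace bc1 T_trace T0_trace.
Let T1_linear : linear (T1 : M1 -> k^o). Proof. by case: T1_trace. Qed.

Lemma phi_exists (u : U) : exists v : V, cincl v = cphi xs i1 e1 (cincl u).
Proof. exact: cincl_onto (cphi_comm bc1 u). Qed.

Lemma hat_exists (v : V) : exists b : B, cincl b = cphi next i2 e2 (cincl v).
Proof. by apply: cincl_onto => m; apply: (cphi_comm bc2). Qed.

(** Both parts of weak irreducibility pass from [C_M(N)] to [C_M1(M)] along
    [phi]. *)
Lemma V_transport (t : V -> k) : (forall v, t v = T1 (cincl v)) ->
  Kanzaki_separable V /\ nondegenerate_trace t.
Proof.
move=> tE; have [h hE] := choice phi_exists.
have lh : linear h.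
  move=> a u v; apply: cincl_inj.
  by rewrite linearP /= !hE linearP (cphi_linear _ _ _).
have h1 : h 1 = 1 by apply: cincl_inj; rewrite hE rmorph1 (cphi1 bc1) rmorph1.
have hM u v : h (u * v) = h v * h u.
  by apply: cincl_inj; rewrite [RHS]rmorphM /= !hE (cphi_mul bc1).
have h_onto v : exists u, h u = v.
  have [u uE _] := cphi_onto bc1 v.
  by exists u; apply: cincl_inj; rewrite hE uE.
split; first exact: anti_iso_Kanzaki lh h1 hM h_onto U_Kanzaki.
apply: (anti_iso_nondegenerate lh hM h_onto _ _ U_nondeg) => [u|].
  by rewrite tE hE T1_cphi.
split=> [a u v|u v]; rewrite !tE.
  by rewrite linearP /=; apply: T1_linear.
by rewrite !rmorphM /= T1_trace.2.
Qed.

Variable sA : seq (A * A).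
Hypothesis sAP : dual_bases i1 E1 [seq (val p.1, val p.2) | p <- sA].

Lemma tower_exists : exists hat : V -> B, jones_tower i0 E2 e1 e2 lam T1 hat.
Proof.
have [hat hatE] := choice hat_exists; exists hat.
have E1_1 : E1 1 = 1 by apply: (bc_E1_1 bc1 index).
have nindex := next_index bc1 E0_1.
have sym1 := E1_sym bc1 E0_sym.
split.
- exact: (bc_lam bc1).
- exact: (bc_E1_bimod bc2).
- exact: (bc_E1_1 bc2 nindex).
- exact: (bc_E1e bc2).
- exact: (bc_pulll bc2).
- exact: (bc_pullr bc2).
- exact: (bc_comm bc2).
- exact: (bc_comm bc1).
- exact: e1_e2_e1 bc1 bc2.
- by rewrite (bc_sandwich bc2) (bc_E1e bc1) !linearZ /= !rmorph1 -scalerAl mul1r.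
- exact: (bc_ind bc1).
- by exists next; apply: (bc_one bc2).
- exact: T1_trace.
- exact: (bc_trace bc2 T0_trace T1_trace).2.
- exact: (bc_shadow bc1).
- move=> v; have [u uE ve] := cphi_onto bc1 v.
  rewrite ve uE T1_cphi /T1 (bc_E1l bc1) (bc_E1e bc1) -scalerAr mulr1.
  by rewrite T0Z.
- by move=> v x; rewrite hatE; apply: (cphi_comm bc2).
- by move=> v; rewrite hatE; apply: (cphi_e bc2).
- by move=> v; rewrite hatE; apply: (e_cphi bc2).
- move=> a aA a0.
  have [aE _] := sAP a; rewrite -aE big_map big1 // => p _.
  have [n|u uE] := @cincl_onto _ _ _ i0 (E1 (a * cincl p.1)).
    rewrite -(bc_E1r bc1) -(bc_E1l bc1) -mulrA (cincl_comm p.1 n) !mulrA.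
    by rewrite -[i1 (i0 n)]/((i1 \o i0) n) /= aA.
  have -> : E1 (a * val p.1) = 0.
    rewrite -[val p.1]/(cincl p.1) -uE.
    suff -> : u = 0 by rewrite raddf0.
    apply: U_nondeg.2 => u'; rewrite rmorphM /= uE -(bc_E1r bc1) -mulrA.
    apply: a0 => n; rewrite -mulrA -rmorphM cincl_comm rmorphM mulrA.
    by rewrite (cincl_comm p.1 n) mulrA.
  by rewrite raddf0 mul0r.
Qed.

End TowerOfBasicConstructions.

Theorem theorem3p19 (k : fieldType) (F : frobenius_ext k) (lam : k)
    (lam_neq0 : lam != 0) (T : fsub F -> k)
    (Hmarkov : symmetric_markov_ext lam T)
    (Hprod : symmetric_product lam_neq0 T)
    (Hirr : weakly_irreducible T)
    (Hdepth2 : depth2 F lam_neq0) :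
  weak_hopf_algebra (B_comul lam_neq0 T) (B_counit lam_neq0 T)
                    (B_antipode lam_neq0 T)
  /\ semisimple (centB F lam_neq0).
Proof.
pose F1 := F1 F lam_neq0; pose F2 := F2 F lam_neq0.
have [[[_ E1 index] T_trace _ T0_trace] E_sym] := Hmarkov.
have [[sA sAP] [D DP]] := Hdepth2; have [UK Und] := Hirr.
have bc1 : basic_construction (fincl F) (fE F) (fdual F) (fincl F1) (fE F1) (be F) lam
  := basic_ext_construction F lam_neq0.
have pureE x y : bpure x y = fincl F1 x * be F * fincl F1 y :> fext F1.
  exact: basic_pureE.
have nextE : fdual F1 = next_dual (fdual F) (fincl F1) (be F) lam.
  exact: fdual_basic_ext.
have bc2 : basic_construction (fincl F1) (fE F1)
    (next_dual (fdual F) (fincl F1) (be F) lam) (fincl F2) (fE F2) (be F1) lam.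
  by rewrite -nextE; apply: basic_ext_construction.
have symm : \sum_(p <- fdual F) p.2 * p.1 = lam^-1 *: 1 \/
    forall u : relative_centralizer (fincl F),
      T (fE F (cincl u)) = T (fE F (fE F1
        (cphi (fdual F) (fincl F1) (be F) (cincl u)))).
  case: Hprod => [|h]; [by left | right=> u].
  rewrite [LHS]h /T1 /phi; congr (T (fE F (fE F1 _))).
  by apply: eq_bigr => p _; rewrite pureE.
have [hat J] := tower_exists bc1 bc2 E1 E_sym index T_trace T0_trace symm Und sAP.
pose tV (v : centV F lam_neq0) := T2 T (i2 F lam_neq0 (val v)).
have tVE v : tV v = T (fE F (fE F1 (cincl v))).
  rewrite /tV /T2 /T1 /T0 -[i2 _ _ _]mul1r; congr (T (fE F (fE F1 _))).
  by rewrite (bc_E1r bc2) (jt_E1 J) mul1r.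
have [VK tVP] := V_transport bc1 T_trace T0_trace symm UK Und tVE.
have fP : symmetric_separability_element (sep_elt F lam_neq0) by apply: xgetPex.
have [w'w ww'] : w_elt lam_neq0 T * w_inv lam_neq0 T = 1
    /\ w_inv lam_neq0 T * w_elt lam_neq0 T = 1.
  exact: (xgetPex 0 (sep_trace_inv tVP fP)).
have wE : w_inv lam_neq0 T = sep_trace tV (sep_elt F lam_neq0) by [].
split; last first.
  apply: (tower_semisimple J fP tVP w'w ww' wE DP).
  transitivity (\sum_(p <- [seq (val p.1, val p.2) | p <- D]) p.1 * p.2).
    by rewrite big_map.
  rewrite (dual_bases_index DP (@fdualP _ F2)) fdual_basic_ext nextE.
  exact: next_index bc2 (bc_E1_1 bc1 index).
pose P := dpair (fincl F2) (fE F2) (be F) (be F1) lam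
             (fun x => T (fE F (fE F1 x))) (w_elt lam_neq0 T).
have pairE (a : centA F lam_neq0) (b : centB F lam_neq0) :
    pairing T a b = P (cincl a) (cincl b) by rewrite /P dpair_def.
have A_onto a : in_A (fincl F) (fincl F1) a ->
    exists a' : centA F lam_neq0, cincl a' = a by apply: cincl_onto.
apply: (tower_weak_hopf J fP tVP w'w ww' wE DP).
- move=> b; have [s sP _] := comul_exists J fP tVP w'w ww' wE DP b.
  pose Q (t : ktensor (centB F lam_neq0) (centB F lam_neq0)) :=
    forall a1 a2 : centA F lam_neq0,
    ksum (fun b1 b2 => pairing T a1 b1 * pairing T a2 b2) t = pairing T (a1 * a2) b.
  have exQ : exists t, Q t.
    exists (\sum_(p <- s) kpure p.1 p.2) => a1 a2.
    transitivity (ksum (fun b1 b2 => P (cincl a1) (cincl b1) * P (cincl a2) (cincl b2))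
                       (\sum_(p <- s) kpure p.1 p.2)).
      by rewrite /ksum /tsum /fsum; apply: eq_bigr => p _; rewrite !pairE.
    rewrite (ksum_seq s (dpair2_bilin J (w_elt lam_neq0 T) (cincl a1) (cincl a2))).
    by rewrite pairE rmorphM; apply: sP; apply: cincl_comm.
  have QP : Q (B_comul lam_neq0 T b) := xgetPex 0 exQ.
  move=> a a' /A_onto[{}a <-] /A_onto[{}a' <-].
  rewrite -rmorphM -[RHS]pairE -QP /ksum /tsum /fsum.
  by apply: eq_bigr => p _; rewrite !pairE.
- by move=> b; rewrite /B_counit pairE rmorph1.
- move=> b; apply/(antipode_ofE J w'w ww' DP) => a /A_onto[{}a <-].
  have [c /(antipode_ofE J w'w ww' DP) cP] :=
    antipode_exists J (w_elt lam_neq0 T) (w_inv lam_neq0 T) DP b.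
  pose R (b' : centB F lam_neq0) := forall a, pairing T a b = pairing' T a b'.
  have exR : exists b', R b'.
    by exists c => a0; rewrite pairE; apply/cP/cincl_comm.
  by rewrite -[LHS]pairE (xgetPex 0 exR).
Qed.
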